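(* Let the standing assumptions (see context) hold for $T,m,n,r,F,B,L_F,\varepsilon_r$. There exists $h_*>0$, depending only on $m,n,r$ and $L_F$, with the following property. Let $Y_0\in\mathbb{R}^{m\times n}$ have rank $r$, let $V_0\in\mathbb{R}^{n\times r}$ have orthonormal columns with $Y_0=Y_0V_0V_0^\top$, let $0<h\le h_*$ and $0\le t_0\le T-h$, and let $A$ solve $$\dot A(s)=F(t_0+s,A(s)),\qquad A(0)=Y_0,\qquad 0\le s\le T-t_0.$$ Then there is an absolutely continuous curve $\widetilde Y:[0,h]\to\mathbb{R}^{m\times n}$ with $\widetilde Y(0)=Y_0$ and $\operatorname{rank}(\widetilde Y(s))=r$ for all $s\in[0,h]$ such that, for almost every $0\le s\le h$, $$\|\dot{\widetilde Y}(s)-F(t_0+s,\widetilde Y(s))\|\le\sqrt{mn}\,\varepsilon_r.$$ Moreover, for all $0\le s\le h$, $$\|\widetilde Y(s)-A(s)\|\le\sqrt{mn}\,\varepsilon_r\,s\,e^{L_Fs},$$ and there is $Q_s\in\mathbb{R}^{r\times n}$ with $$\widetilde Y(s)=(\widetilde Y(s)V_0)Q_s,\qquad\|Q_s\|_2\le3.$$ All these bounds are independent of the singular values of $Y_0$.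
   Context: $\|\cdot\|$ is the Frobenius norm and $\|\cdot\|_2$ the matrix operator norm. Standing assumptions: $T>0$; $m,n,r$ are integers with $1\le r<\min(m,n)$; $F:[0,T]\times\mathbb{R}^{m\times n}\to\mathbb{R}^{m\times n}$ is continuous, and there are constants $B,L_F$ such that for all $t\in[0,T]$ and $X,Z\in\mathbb{R}^{m\times n}$, $$\|F(t,X)\|\le B,\qquad\|F(t,X)-F(t,Z)\|\le L_F\|X-Z\|;$$ and for some $\varepsilon_r\ge0$, for all $t\in[0,T]$ and every rank-$r$ matrix $Y=USV^\top$ ($U\in\mathbb{R}^{m\times r}$, $V\in\mathbb{R}^{n\times r}$ with orthonormal columns, $S\in\mathbb{R}^{r\times r}$ invertible), $$\|(I-UU^\top)F(t,Y)(I-VV^\top)\|\le\varepsilon_r.$$ *)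

(* Defs.v *)
From mathcomp Require Import all_boot all_order all_algebra.
From mathcomp Require Import all_classical all_reals all_analysis.
Import numFieldNormedType.Exports.
Import Order.TTheory GRing.Theory Num.Theory.

Set Implicit Arguments.
Unset Strict Implicit.
Unset Printing Implicit Defensive.

Local Open Scope classical_set_scope.
Local Open Scope ring_scope.

(* The library norm `|A| on matrices is the max norm, so the Frobenius norm is
   introduced separately; the two induce the same topology. *)
Definition frob_norm (R : realType) (m n : nat) (A : 'M[R]_(m, n)) : R :=
  Num.sqrt (\sum_(i < m) \sum_(j < n) A i j ^+ 2).

(* On column vectors, [frob_norm] is the Euclidean norm.  The set is nonempty
   and bounded above by [frob_norm A], so [sup] is a genuine supremum. *)
Definition op_norm (R : realType) (m n : nat) (A : 'M[R]_(m, n)) : R :=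
  sup [set frob_norm (A *m x) | x in [set x : 'cV[R]_n | frob_norm x <= 1]].

(* Derivative relative to [D]: one-sided at the endpoints of an interval.
   The values of [f] outside [D `|` [set s]] are irrelevant. *)
Definition has_deriv_within (R : realType) (V : normedModType R)
    (D : set R) (f : R -> V) (s : R) (f' : V) : Prop :=
  (u - s)^-1 *: (f u - f s) @[u --> within D s^'] --> f'.

Definition abs_continuous_on (R : realType) (m n : nat) (a b : R)
    (f : R -> 'M[R]_(m, n)) : Prop :=
  forall e : R, 0 < e -> exists2 d : R, 0 < d &
    forall (N : nat) (x y : 'I_N -> R),
      (forall i, [/\ a <= x i, x i <= y i & y i <= b]) ->
      trivIset [set: 'I_N] (fun i => `]x i, y i[%classic) ->
      \sum_(i < N) (y i - x i) < d ->
      \sum_(i < N) frob_norm (f (y i) - f (x i)) < e.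

(* Main.v *)
Require Import Defs.
From mathcomp Require Import all_boot all_order all_algebra.
From mathcomp Require Import all_classical all_reals all_analysis.
From mathcomp Require Import perm ring lra.
Import numFieldNormedType.Exports.
Import Order.TTheory GRing.Theory Num.Theory.

(** The curve is sought in the form [Yt s = Phi s *m Y0 *m Psi s] with
    [Phi s], [Psi s] within Frobenius distance 1/2 of the identity.  Such
    factors are invertible, so the rank cannot drop however small the singular
    values of [Y0] are; and [Q = (V0^T Psi V0)^-1 V0^T Psi] has norm at most
    (3/2)/(1/2) = 3 ([near_equiv_rank], [near_equiv_graph]).  The velocities
    produced by moving the factors are the matrices [M *m Y + Y *m N], so
    everything rests on approximating [F t Y] by such a matrix with [M] and [N]
    bounded in terms of [m], [n] and [LF] only.

    This is [tangent_split].  In singular bases [u_i], [v_j] of [Y], a matrix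
    [M *m Y + Y *m N] with bounded [M], [N] is one whose [(i, j)] entry is
    [O(tau)], where [tau] is the sum of the singular values attached to [u_i]
    and [v_j].  Now exchange [u_i] and [v_j] in [Y] with directions [u_a] and
    [v_b] of singular value zero; these exist because [r < min(m, n)].  The
    result [Z] again has rank [r], lies within [2 * tau] of [Y], and has [u_i]
    and [v_j] orthogonal to its column and row spaces.  The normal-component
    hypothesis at [Z] and the Lipschitz condition give
    [|u_i^T F(t, Y) v_j| <= eps + 2 * LF * tau] ([entry_bound]).
    Multiplying each entry by [c * tau / (eps + c * tau)] with
    [c = 2 * LF + 1] leaves an [O(tau)] entry and an error at most [eps]; over
    the [m * n] entries this is the constant [sqrt (m * n)].  As [c > 2 * LF],
    the error at an entry with [tau > 0] is strictly below [eps], so for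
    [eps > 0] the total is strictly below [sqrt (m * n) * eps], uniformly as
    long as the norm of [Y] stays away from zero.

    That margin absorbs a discretisation error: freezing [M] and [N] on
    sufficiently short steps of equal length gives a piecewise smooth curve
    with finitely many corners which meets the defect bound exactly
    ([admissible_extend], [approx_curve]), and a Gronwall estimate on each step
    compares it with [A].  The singular values of [Y0] influence only the
    number of steps.

    For [eps = 0] there is no margin, and the curve is [A] itself: it is the
    uniform limit of the curves built for [eps' > 0], and both the set of
    matrices [Phi *m Y0 *m Psi] with factors near the identity and the Lipschitz
    bound survive the limit ([near_equiv_closed]). *)

Set Implicit Arguments.
Unset Strict Implicit.
Unset Printing Implicit Defensive.

Local Open Scope classical_set_scope.
Local Open Scope ring_scope.

(** * The Frobenius inner product *)

Definition mxdot (R : realType) (m n : nat) (A B : 'M[R]_(m, n)) : R :=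
  \tr (A^T *m B).

Lemma mxdotE (R : realType) (m n : nat) (A B : 'M[R]_(m, n)) :
  mxdot A B = \sum_i \sum_j A i j * B i j.
Proof.
rewrite /mxdot exchange_big; apply: eq_bigr => j _; rewrite !mxE.
by apply: eq_bigr => i _; rewrite mxE.
Qed.

Lemma mxdotC (R : realType) (m n : nat) (A B : 'M[R]_(m, n)) :
  mxdot A B = mxdot B A.
Proof. by rewrite /mxdot -mxtrace_tr trmx_mul trmxK. Qed.

Lemma mxdotDl (R : realType) (m n : nat) (A B C : 'M[R]_(m, n)) :
  mxdot (A + B) C = mxdot A C + mxdot B C.
Proof. by rewrite /mxdot linearD mulmxDl linearD. Qed.

Lemma mxdotDr (R : realType) (m n : nat) (A B C : 'M[R]_(m, n)) :
  mxdot C (A + B) = mxdot C A + mxdot C B.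
Proof. by rewrite /mxdot mulmxDr linearD. Qed.

Lemma mxdotZl (R : realType) (m n : nat) (a : R) (A B : 'M[R]_(m, n)) :
  mxdot (a *: A) B = a * mxdot A B.
Proof. by rewrite /mxdot linearZ /= -scalemxAl linearZ. Qed.

Lemma mxdotZr (R : realType) (m n : nat) (a : R) (A B : 'M[R]_(m, n)) :
  mxdot A (a *: B) = a * mxdot A B.
Proof. by rewrite mxdotC mxdotZl mxdotC. Qed.

Lemma mxdotNl (R : realType) (m n : nat) (A B : 'M[R]_(m, n)) :
  mxdot (- A) B = - mxdot A B.
Proof. by rewrite -scaleN1r mxdotZl mulN1r. Qed.

Lemma mxdotNr (R : realType) (m n : nat) (A B : 'M[R]_(m, n)) :
  mxdot A (- B) = - mxdot A B.
Proof. by rewrite mxdotC mxdotNl mxdotC. Qed.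

Lemma mxdot_mull (R : realType) (m n p : nat) (U : 'M[R]_(m, p))
    (A : 'M[R]_(p, n)) (B : 'M[R]_(m, n)) :
  mxdot (U *m A) B = mxdot A (U^T *m B).
Proof. by rewrite /mxdot trmx_mul mulmxA. Qed.

Lemma mxdot_mulr (R : realType) (m n p : nat) (A : 'M[R]_(m, p))
    (V : 'M[R]_(p, n)) (B : 'M[R]_(m, n)) :
  mxdot (A *m V) B = mxdot A (B *m V^T).
Proof. by rewrite /mxdot trmx_mul -mulmxA mxtrace_mulC mulmxA. Qed.

Lemma mxdot_ge0 (R : realType) (m n : nat) (A : 'M[R]_(m, n)) :
  0 <= mxdot A A.
Proof.
by rewrite mxdotE; do 2!apply: sumr_ge0 => ? _; rewrite -expr2 sqr_ge0.
Qed.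

Lemma frob_normE (R : realType) (m n : nat) (A : 'M[R]_(m, n)) :
  frob_norm A = Num.sqrt (mxdot A A).
Proof.
by rewrite /frob_norm mxdotE.
Qed.

Lemma frob_sqr (R : realType) (m n : nat) (A : 'M[R]_(m, n)) :
  frob_norm A ^+ 2 = mxdot A A.
Proof. by rewrite frob_normE sqr_sqrtr// mxdot_ge0. Qed.

Lemma frob_ge0 (R : realType) (m n : nat) (A : 'M[R]_(m, n)) :
  0 <= frob_norm A.
Proof. exact: sqrtr_ge0. Qed.

Lemma frob_le_sqr (R : realType) (m n : nat) (A : 'M[R]_(m, n)) (c : R) :
  0 <= c -> mxdot A A <= c ^+ 2 -> frob_norm A <= c.
Proof. by move=> c0; rewrite -frob_sqr ler_pXn2r ?nnegrE ?frob_ge0. Qed.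

Lemma frob0 (R : realType) (m n : nat) : frob_norm (0 : 'M[R]_(m, n)) = 0.
Proof. by rewrite frob_normE /mxdot mulmx0 mxtrace0 sqrtr0. Qed.

Lemma le_entry_frob (R : realType) (m n : nat) (A : 'M[R]_(m, n)) i j :
  `|A i j| <= frob_norm A.
Proof.
rewrite -(@ler_pXn2r _ 2) ?nnegrE ?frob_ge0// frob_sqr real_normK ?num_real//.
rewrite mxdotE (bigD1 i)//= (bigD1 j)//= -expr2 -addrA lerDl addr_ge0//.
  by apply: sumr_ge0 => k _; rewrite -expr2 sqr_ge0.
by do 2!apply: sumr_ge0 => ? _; rewrite -expr2 sqr_ge0.
Qed.

Lemma frob_eq0 (R : realType) (m n : nat) (A : 'M[R]_(m, n)) :
  frob_norm A = 0 -> A = 0.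
Proof.
move=> A0; apply/matrixP => i j; rewrite mxE; apply/eqP.
by rewrite -normr_le0 -A0 le_entry_frob.
Qed.

Lemma frobZ (R : realType) (m n : nat) (a : R) (A : 'M[R]_(m, n)) :
  frob_norm (a *: A) = `|a| * frob_norm A.
Proof.
rewrite !frob_normE mxdotZl mxdotZr mulrA -expr2 sqrtrM ?sqr_ge0//.
by rewrite sqrtr_sqr.
Qed.

Lemma frobN (R : realType) (m n : nat) (A : 'M[R]_(m, n)) :
  frob_norm (- A) = frob_norm A.
Proof. by rewrite -scaleN1r frobZ normrN1 mul1r. Qed.

Lemma frob_tr (R : realType) (m n : nat) (A : 'M[R]_(m, n)) :
  frob_norm A^T = frob_norm A.
Proof. by rewrite !frob_normE /mxdot trmxK mxtrace_mulC. Qed.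

Lemma mxdot_le_frob (R : realType) (m n : nat) (A B : 'M[R]_(m, n)) :
  mxdot A B <= frob_norm A * frob_norm B.
Proof.
have [B0|B0] := eqVneq (frob_norm B) 0.
  by rewrite (frob_eq0 B0) /mxdot mulmx0 mxtrace0 frob0 mulr0.
have Bp : 0 < frob_norm B by rewrite lt_def B0 frob_ge0.
suff : mxdot A B ^+ 2 <= (frob_norm A * frob_norm B) ^+ 2.
  move=> h; apply: (le_trans (ler_norm _)).
  rewrite -(@ler_pXn2r _ 2) ?nnegrE ?mulr_ge0 ?frob_ge0//.
  by rewrite real_normK ?num_real.
have := mxdot_ge0 (frob_norm B ^+ 2 *: A - mxdot A B *: B).
rewrite !(mxdotDl, mxdotDr, mxdotNl, mxdotNr, mxdotZl, mxdotZr).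
rewrite (mxdotC B A) -!frob_sqr; set x := mxdot A B.
set a := frob_norm A; set b := frob_norm B.
move=> h; have : 0 <= b ^+ 2 * ((a * b) ^+ 2 - x ^+ 2).
  by apply: (le_trans h); rewrite le_eqVlt; apply/orP; left; apply/eqP; ring.
by rewrite pmulr_rge0 ?exprn_gt0// subr_ge0.
Qed.

Lemma frobD (R : realType) (m n : nat) (A B : 'M[R]_(m, n)) :
  frob_norm (A + B) <= frob_norm A + frob_norm B.
Proof.
apply: frob_le_sqr; first by rewrite addr_ge0 ?frob_ge0.
rewrite !(mxdotDl, mxdotDr) (mxdotC B A) -!frob_sqr.
have := mxdot_le_frob A B; set x := mxdot A B; nra.
Qed.

Lemma frobB (R : realType) (m n : nat) (A B : 'M[R]_(m, n)) :
  frob_norm (A - B) = frob_norm (B - A).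
Proof. by rewrite -opprB frobN. Qed.

Lemma frob_sum (R : realType) (m n : nat) (I : finType)
    (A : I -> 'M[R]_(m, n)) :
  frob_norm (\sum_i A i) <= \sum_i frob_norm (A i).
Proof.
elim/big_ind2 : _ => [|x a y b xa yb|//]; first by rewrite frob0.
by rewrite (le_trans (frobD _ _))// lerD.
Qed.

Lemma frob_mul (R : realType) (m n p : nat) (A : 'M[R]_(m, p))
    (B : 'M[R]_(p, n)) :
  frob_norm (A *m B) <= frob_norm A * frob_norm B.
Proof.
apply: frob_le_sqr; first by rewrite mulr_ge0 ?frob_ge0.
have rowE i j : (A *m B) i j = mxdot (row i A)^T (col j B).
  rewrite mxE mxdotE; apply: eq_bigr => k _.
  by rewrite big_ord1 !mxE.
have frow i : frob_norm (row i A)^T ^+ 2 = \sum_k A i k ^+ 2.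
  rewrite frob_sqr mxdotE; apply: eq_bigr => k _.
  by rewrite big_ord1 !mxE expr2.
have fcol j : frob_norm (col j B) ^+ 2 = \sum_k B k j ^+ 2.
  rewrite frob_sqr mxdotE; apply: eq_bigr => k _.
  by rewrite big_ord1 !mxE expr2.
rewrite mxdotE exprMn !frob_sqr 2!mxdotE mulr_suml; apply: ler_sum => i _.
rewrite [X in _ <= _ * X]exchange_big mulr_sumr; apply: ler_sum => j _.
rewrite (eq_bigr (fun k => A i k ^+ 2)); last by move=> ? _; rewrite expr2.
rewrite [X in _ <= _ * X](eq_bigr (fun k => B k j ^+ 2)); last first.
  by move=> ? _; rewrite expr2.
rewrite -frow -fcol -exprMn -expr2 rowE.
rewrite -[leLHS]real_normK ?num_real// ler_pXn2r ?nnegrE ?mulr_ge0 ?frob_ge0//.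
rewrite ler_norml mxdot_le_frob andbT lerNl -mxdotNl.
by rewrite (le_trans (mxdot_le_frob _ _))// frobN.
Qed.

Lemma frob_mulW (R : realType) (m n p : nat) (A : 'M[R]_(m, p))
    (B : 'M[R]_(p, n)) (a b : R) :
  frob_norm A <= a -> frob_norm B <= b -> frob_norm (A *m B) <= a * b.
Proof.
by move=> Aa Bb; rewrite (le_trans (frob_mul _ _))// ler_pM ?frob_ge0.
Qed.

Lemma frob_isol (R : realType) (m n p : nat) (U : 'M[R]_(m, p))
    (A : 'M[R]_(p, n)) :
  U^T *m U = 1%:M -> frob_norm (U *m A) = frob_norm A.
Proof. by move=> UU; rewrite !frob_normE mxdot_mull mulmxA UU mul1mx. Qed.

Lemma frob_isor (R : realType) (m n p : nat) (V : 'M[R]_(n, p))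
    (A : 'M[R]_(m, p)) :
  V^T *m V = 1%:M -> frob_norm (A *m V^T) = frob_norm A.
Proof. by move=> VV; rewrite -frob_tr trmx_mul trmxK frob_isol ?frob_tr. Qed.

(** [U^T] inverts the isometry [U] on its range, hence contracts. *)
Lemma frob_coisol (R : realType) (m n p : nat) (U : 'M[R]_(m, p))
    (A : 'M[R]_(m, n)) :
  U^T *m U = 1%:M -> frob_norm (U^T *m A) <= frob_norm A.
Proof.
move=> UU; have [->|B0] := eqVneq (frob_norm (U^T *m A)) 0.
  exact: frob_ge0.
rewrite -(@ler_pM2l _ (frob_norm (U^T *m A))); last first.
  by rewrite lt_def B0 frob_ge0.
rewrite -expr2 frob_sqr -mxdot_mull -(frob_isol (U^T *m A) UU).
exact: mxdot_le_frob.
Qed.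

Lemma frob_coisor (R : realType) (m n p : nat) (V : 'M[R]_(n, p))
    (A : 'M[R]_(m, n)) :
  V^T *m V = 1%:M -> frob_norm (A *m V) <= frob_norm A.
Proof.
by move=> VV; rewrite -frob_tr trmx_mul -(frob_tr A) frob_coisol.
Qed.

Lemma frob_bound (R : realType) (m n : nat) (A : 'M[R]_(m, n)) (c : R) :
  (forall i j, `|A i j| <= c) -> frob_norm A <= (m * n)%:R * c.
Proof.
move=> Ac.
have Z (k : 'M[R]_(m, n)) : (forall i j, `|k i j| <= c) -> 0 <= (m * n)%:R * c.
  case: m k {A Ac} => [|m'] k; first by rewrite mul0n mul0r.
  case: n k => [|n'] k; first by rewrite muln0 mul0r.
  by move=> /(_ ord0 ord0) h; rewrite mulr_ge0// (le_trans _ h).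
apply: frob_le_sqr; first exact: (Z A Ac).
apply: (@le_trans _ _ (\sum_(i < m) \sum_(j < n) c ^+ 2)).
  rewrite mxdotE; apply: ler_sum => i _; apply: ler_sum => j _.
  rewrite -expr2 -real_normK ?num_real// lerXn2r ?nnegrE//.
  exact: le_trans (Ac i j).
rewrite !sumr_const !card_ord -mulrnA -(mulr_natl (c ^+ 2)) exprMn.
rewrite ler_wpM2r ?sqr_ge0//.
rewrite mulnC -natrX ler_nat -mulnn; case: (m * n)%N => // k.
by rewrite leq_pmulr.
Qed.

(** * Continuity and compactness for matrices *)

Lemma cvg_sum (R : realType) (I : finType) (T : Type) (F : set_system T)
    {FF : Filter F} (f : I -> T -> R) (l : I -> R) :
  (forall i, f i x @[x --> F] --> l i) ->
  \sum_i f i x @[x --> F] --> \sum_i l i.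
Proof.
move=> fl; apply: (@cvg_big R I +%R 0 xpredT _ T F) => // -[x y].
exact: add_continuous.
Qed.

Lemma cvg_mx (R : realType) (m n : nat) (T : Type) (F : set_system T)
    {FF : Filter F} (f : T -> 'M[R]_(m, n)) (l : 'M[R]_(m, n)) :
  (forall i j, f x i j @[x --> F] --> l i j) -> f x @[x --> F] --> l.
Proof.
move=> fl; apply/cvgrPdist_le => e e0; near=> x.
rewrite /Num.Def.normr/= mx_normrE (bigmax_le _ (ltW e0))//= => i _.
rewrite !mxE; move: i; near: x; apply: filter_forall => i.
exact: ((cvgrPdist_le _ _).1 (fl i.1 i.2)).
Unshelve. all: by end_near. Qed.

Lemma cvg_mx_entry (R : realType) (m n : nat) (T : Type) (F : set_system T)
    {FF : Filter F} (f : T -> 'M[R]_(m, n)) (l : 'M[R]_(m, n)) i j :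
  f x @[x --> F] --> l -> f x i j @[x --> F] --> l i j.
Proof.
move=> fl; apply: (@cvg_comp _ _ _ f (fun M => M i j) _ _ _ fl).
exact: coord_continuous.
Qed.

Lemma cvg_mulmx (R : realType) (m n p : nat) (T : Type) (F : set_system T)
    {FF : Filter F} (f : T -> 'M[R]_(m, p)) (g : T -> 'M[R]_(p, n))
    (A : 'M[R]_(m, p)) (B : 'M[R]_(p, n)) :
  f x @[x --> F] --> A -> g x @[x --> F] --> B ->
  f x *m g x @[x --> F] --> A *m B.
Proof.
move=> fA gB; apply: cvg_mx => i j.
rewrite (_ : (fun x => _) = (fun x => \sum_k f x i k * g x k j)); last first.
  by apply/funext => x; rewrite mxE.
rewrite mxE; apply: cvg_sum => k.
by apply: cvgM; exact: cvg_mx_entry.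
Qed.

Lemma cvg_trmx (R : realType) (m n : nat) (T : Type) (F : set_system T)
    {FF : Filter F} (f : T -> 'M[R]_(m, n)) (A : 'M[R]_(m, n)) :
  f x @[x --> F] --> A -> (f x)^T @[x --> F] --> A^T.
Proof.
move=> fA; apply: cvg_mx => i j; rewrite mxE.
under eq_fun do rewrite mxE.
exact: cvg_mx_entry.
Qed.

Lemma cvg_mxdot (R : realType) (m n : nat) (T : Type) (F : set_system T)
    {FF : Filter F} (f g : T -> 'M[R]_(m, n)) (A B : 'M[R]_(m, n)) :
  f x @[x --> F] --> A -> g x @[x --> F] --> B ->
  mxdot (f x) (g x) @[x --> F] --> mxdot A B.
Proof.
move=> fA gB; rewrite mxdotE; under eq_fun do rewrite mxdotE.
do 2!(apply: cvg_sum => ?).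
by apply: cvgM; exact: cvg_mx_entry.
Qed.

Lemma cvg_frob (R : realType) (m n : nat) (T : Type) (F : set_system T)
    {FF : Filter F} (f : T -> 'M[R]_(m, n)) (A : 'M[R]_(m, n)) :
  f x @[x --> F] --> A -> frob_norm (f x) @[x --> F] --> frob_norm A.
Proof.
move=> fA; rewrite frob_normE; under eq_fun do rewrite frob_normE.
apply: (@cvg_comp _ _ _ (fun x => mxdot (f x) (f x)) Num.sqrt F
  (nbhs (mxdot A A))).
  exact: cvg_mxdot.
exact: sqrt_continuous.
Qed.

Lemma compact_mx (R : realType) (m n : nat) (A : set 'M[R]_(m, n)) (c : R) :
  closed A -> (forall X, A X -> frob_norm X <= c) -> compact A.
Proof.
move=> clA Ac.
pose B := [set v : 'rV[R]_(m * n) | forall i, `[- c, c]%classic (v ord0 i)].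
have cB : compact B.
  apply: (@rV_compact _ _ (fun=> `[- c, c]%classic)) => _.
  exact: segment_compact.
have vc : {within B, continuous (@vec_mx R m n)}.
  apply: continuous_subspaceT => v; apply: (@cvg_mx _ _ _ _ (nbhs v)) => i j.
  rewrite mxE; under eq_fun do rewrite mxE.
  exact: coord_continuous.
apply: subclosed_compact clA (continuous_compact vc cB) _ => X AX.
exists (mxvec X); last exact: mxvecK.
move=> k /=; case/mxvec_indexP: k => i j; rewrite mxvecE in_itv/=.
by rewrite -ler_norml (le_trans (le_entry_frob _ _ _))// Ac.
Qed.

Lemma compact_frob_ball (R : realType) (m n : nat) (X0 : 'M[R]_(m, n)) (c : R) :
  compact [set X | frob_norm (X - X0) <= c].
Proof.
apply: (@compact_mx _ _ _ _ (c + frob_norm X0)); last first.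
  move=> X /= Xc; rewrite -[X](subrK X0).
  by rewrite (le_trans (frobD _ _))// lerD2r.
rewrite (_ : mkset _ = (fun X => frob_norm (X - X0)) @^-1` [set y | y <= c])//.
apply: preimage_closed; last exact: closed_le.
move=> X _; apply: (@cvg_frob _ _ _ _ (nbhs X) _ (fun X => X - X0)).
apply: cvgB; [exact: cvg_id|exact: cvg_cst].
Qed.

Lemma compact_orthogonal (R : realType) (m : nat) :
  compact [set U : 'M[R]_m | U^T *m U = 1%:M].
Proof.
apply: (@compact_mx _ _ _ _ (frob_norm (1%:M : 'M[R]_m))); last first.
  by move=> U /= UU; rewrite -[U]mulmx1 frob_isol.
rewrite (_ : mkset _ = (fun U : 'M[R]_m => U^T *m U) @^-1` [set 1%:M])//.
apply: preimage_closed; last first.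
  exact/accessible_closed_set1/hausdorff_accessible/norm_hausdorff.
move=> U _; apply: (@cvg_mulmx _ _ _ _ _ (nbhs U)); last exact: cvg_id.
exact: (@cvg_trmx _ _ _ _ (nbhs U) _ id _ cvg_id).
Qed.

(** Uniform continuity on the compact product of the time interval with a
    ball, stated for displacements in time only. *)
Lemma time_equicontinuity (R : realType) (m n : nat) (T c e : R)
    (F : R -> 'M[R]_(m, n) -> 'M[R]_(m, n)) :
  {within `[0, T]%classic `*` [set: 'M[R]_(m, n)],
    continuous (fun p : R * 'M[R]_(m, n) => F p.1 p.2)} ->
  0 < e ->
  exists2 d : R, 0 < d & forall t t' X, 0 <= t <= T -> 0 <= t' <= T ->
    `|t' - t| < d -> frob_norm X <= c -> frob_norm (F t' X - F t X) <= e.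
Proof.
move=> Fc e0; set D := (_ `*` _) in Fc.
pose K : set (R * 'M[R]_(m, n)) :=
  `[0, T]%classic `*` [set X | frob_norm (X - 0) <= c].
pose P (d : R) (p : R * 'M[R]_(m, n)) := forall t', 0 <= t' <= T ->
  `|t' - p.1| < d -> frob_norm (F t' p.2 - F p.1 p.2) <= e.
have cK : compact K.
  by apply: compact_setX; [exact: segment_compact|exact: compact_frob_ball].
have : \forall d \near 0^'+, K `<=` P d.
  have /near_covering_withinP := (compact_near_coveringP K).1 cK.
  apply=> -[s X] [/= sT _].
  have Dx : D (s, X) by split.
  have /subspace_continuousP/(_ _ Dx) Fx := Fc.
  have : frob_norm (F p.1 p.2 - F s X) @[p --> within D (nbhs (s, X))]
      --> (0 : R).
    rewrite -(frob0 R m n) -(subrr (F s X)).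
    apply: (@cvg_frob _ _ _ _ _ _
      (fun p : R * 'M[R]_(m, n) => F p.1 p.2 - F s X)).
    by apply: cvgB; [exact: Fx|exact: cvg_cst].
  move=> /cvgrPdist_le /(_ (e / 2)); rewrite divr_gt0// => /(_ isT).
  rewrite near_withinE => /nbhs_ballP[rho /= rho0 brho].
  have close p : ball (s, X) rho p -> 0 <= p.1 <= T ->
      frob_norm (F p.1 p.2 - F s X) <= e / 2.
    move=> bp pT; have := brho p bp.
    rewrite sub0r normrN ger0_norm ?frob_ge0//; apply.
    by split => //=; rewrite in_itv.
  exists (ball (s, X) (rho / 2), [set d | d < rho / 2]); first split => /=.
  - by apply: nbhsx_ballx; rewrite divr_gt0.
  - by apply: nbhs_right_lt; rewrite divr_gt0.
  move=> [[s1 X1] d] /= [[/= bs bX] drho] [/= s1T _] t' t'T t's1.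
  rewrite in_itv/= in s1T.
  have h1 : frob_norm (F s1 X1 - F s X) <= e / 2.
    apply: (close (s1, X1)) => //; apply: (@le_ball _ _ _ (rho / 2)) => //.
    by rewrite ler_pdivrMr// ler_peMr ?ltW// ltr1n.
  have h2 : frob_norm (F t' X1 - F s X) <= e / 2.
    apply: (close (t', X1)) => //; split => /=.
      rewrite /ball/= (splitr rho) -(subrKA s1) (le_lt_trans (ler_normD _ _))//.
      by rewrite ltrD// distrC (lt_trans t's1).
    apply: (@le_ball _ _ _ (rho / 2)) => //.
    by rewrite ler_pdivrMr// ler_peMr ?ltW// ltr1n.
  rewrite -(subrKA (F s X)) (le_trans (frobD _ _))// (splitr e) lerD//.
  by rewrite frobB.
move=> Kd; have [d [dK d0]] : exists d, (K `<=` P d) /\ 0 < d.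
  by apply: (@filter_ex _ (0^'+ : set_system R)); apply: filterI => //;
    exact: nbhs_right_gt.
exists d => // t t' X tT t'T tt' Xc.
by apply: (dK (t, X)) => //; split; rewrite /= ?in_itv ?subr0.
Qed.

(** * Singular value decomposition *)

(** First-order optimality of [1] under plane rotations.  Rotating in the plane
    [(i, j)] changes the inner product by [(c - 1) * al + s * be], where [be]
    is the antisymmetric part [X i j - X j i]; as [(c, s)] runs over the unit
    circle, this stays nonpositive only if [be = 0]. *)
Lemma sym_of_trace_max (R : realType) (m : nat) (X : 'M[R]_m) :
  (forall G : 'M[R]_m, G^T *m G = 1%:M -> mxdot G X <= mxdot 1%:M X) ->
  X^T = X.
Proof.
move=> Xmax; apply/matrixP => j i; rewrite mxE.
have [->//|ij] := eqVneq i j.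
pose P : 'M[R]_m := delta_mx i i + delta_mx j j.
pose J : 'M[R]_m := delta_mx i j - delta_mx j i.
have ji : (j == i) = false by rewrite eq_sym (negPf ij).
have PT : P^T = P by rewrite linearD /= !trmx_delta.
have JT : J^T = - J by rewrite linearB /= !trmx_delta opprB.
have dE := (mul_delta_mx_cond, eqxx, ji, negPf ij, mulr1n, mulr0n).
have PP : P *m P = P.
  by rewrite mulmxDl !mulmxDr !dE addr0 add0r.
have PJ : P *m J = J.
  by rewrite mulmxDl !mulmxBr !dE subr0 sub0r.
have JP : J *m P = J.
  by rewrite mulmxBl !mulmxDr !dE addr0 add0r.
have JJ : J *m J = - P.
  by rewrite mulmxBl !mulmxBr !dE sub0r subr0 -opprD.
set al := mxdot P X; set be := mxdot J X.
have beE : be = X i j - X j i.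
  have dX k l : mxdot (delta_mx k l) X = X k l.
    rewrite mxdotE (bigD1 k)//= (bigD1 l)//= mxE !eqxx mul1r.
    rewrite big1 => [|l' /negPf l'l]; last by rewrite mxE l'l andbF mul0r.
    rewrite big1 => [|k' /negPf k'k]; first by rewrite !addr0.
    by rewrite big1// => l' _; rewrite mxE k'k mul0r.
  by rewrite /be mxdotDl mxdotNl !dX.
clearbody P J.
have rot (c s : R) : c ^+ 2 + s ^+ 2 = 1 -> (c - 1) * al + s * be <= 0.
  move=> cs; have := Xmax (1%:M + ((c - 1) *: P + s *: J)).
  rewrite !mxdotDl !mxdotZl gerDl; apply.
  rewrite !linearD/= !linearZ/= PT JT trmx1.
  rewrite !(mulmxDl, mulmxDr) !mul1mx !mulmx1 -!scalemxAl.
  rewrite !mulNmx ?mulmx1 PP PJ JP JJ.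
  transitivity (1%:M + (c ^+ 2 + s ^+ 2 - 1) *: P); last first.
    by rewrite cs subrr scale0r addr0.
  by apply/matrixP => k l; rewrite !mxE; ring.
suff : be = 0 by move/eqP; rewrite beE subr_eq0 => /eqP.
apply/eqP/negPn/negP => be0.
(* The best rotation has [(c, s)] proportional to [(al, be)]. *)
set rho := Num.sqrt (al ^+ 2 + be ^+ 2).
have r2 : rho ^+ 2 = al ^+ 2 + be ^+ 2.
  by rewrite sqr_sqrtr// addr_ge0// sqr_ge0.
have b2 : 0 < be ^+ 2 by rewrite lt_def sqrf_eq0 be0 sqr_ge0.
have r0 : 0 < rho by rewrite sqrtr_gt0 ltr_wpDl// sqr_ge0.
have := rot (al / rho) (be / rho).
rewrite !expr_div_n -mulrDl -r2 divff ?expf_neq0 ?gt_eqF// => /(_ erefl).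
rewrite -(ler_pM2r r0) mul0r.
have -> : ((al / rho - 1) * al + be / rho * be) * rho =
    al ^+ 2 + be ^+ 2 - rho * al by field; rewrite gt_eqF.
rewrite -r2; nra.
Qed.

(** Maximise the inner product of [U^T *m Y *m V] with a fixed diagonal [W]
    having distinct positive weights, over the compact set of pairs of
    orthogonal matrices.  At a maximiser [D] both [D *m W^T] and [W^T *m D] are
    symmetric, hence [D *m (W^T *m W) = (W *m W^T) *m D]; since the squared
    weights are distinct and positive, the off-diagonal entries of [D]
    vanish. *)
Lemma svd_full (R : realType) (m n : nat) (Y : 'M[R]_(m, n)) :
  exists U : 'M[R]_m, exists V : 'M[R]_n,
    [/\ U^T *m U = 1%:M, V^T *m V = 1%:M &
        forall (i : 'I_m) (j : 'I_n), (i : nat) != j ->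
          (U^T *m Y *m V) i j = 0].
Proof.
pose W : 'M[R]_(m, n) := \matrix_(i < m, j < n) (((i : nat) == j)%:R * i.+1%:R).
pose A : set ('M[R]_m * 'M[R]_n) :=
  [set U : 'M[R]_m | U^T *m U = 1%:M] `*` [set V : 'M[R]_n | V^T *m V = 1%:M].
pose f (p : 'M[R]_m * 'M[R]_n) := mxdot W (p.1^T *m Y *m p.2).
have cA : compact A by apply: compact_setX; exact: compact_orthogonal.
have A0 : A !=set0 by exists (1%:M, 1%:M); split; rewrite /= trmx1 mulmx1.
have cf : {within A, continuous f}.
  apply: continuous_subspaceT => p.
  apply: (@cvg_mxdot _ _ _ _ (nbhs p)); first exact: cvg_cst.
  apply: (@cvg_mulmx _ _ _ _ _ (nbhs p)); last exact: cvg_snd.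
  apply: (@cvg_mulmx _ _ _ _ _ (nbhs p)); last exact: cvg_cst.
  by apply: (@cvg_trmx _ _ _ _ (nbhs p)); exact: cvg_fst.
have [[U V]] := compact_EVT_max A0 cA cf.
rewrite inE => -[/= UU VV] UVmax.
exists U, V; split=> //; set D := U^T *m Y *m V.
have DW : W *m D^T = D *m W^T.
  rewrite -[LHS]trmxK trmx_mul trmxK; apply: sym_of_trace_max => G GG.
  have h := UVmax (U *m G, V).
  rewrite inE /f /= trmx_mul -!mulmxA [U^T *m _]mulmxA -/D in h.
  rewrite -!mxdot_mulr mul1mx mxdot_mull; apply: h; split=> //=.
  by rewrite trmx_mul mulmxA -[_ *m U]mulmxA UU mulmx1.
have WD : W^T *m D = D^T *m W.
  rewrite -[LHS]trmxK trmx_mul trmxK; apply: sym_of_trace_max => G GG.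
  have h := UVmax (U, V *m G).
  rewrite inE /f /= mulmxA -/D in h.
  rewrite -!mxdot_mull mulmx1 !(mxdotC _ W); apply: h; split=> //=.
  by rewrite trmx_mul mulmxA -[_ *m V]mulmxA VV mulmx1.
pose nu (p k : nat) : R := (k < p)%:R * k.+1%:R ^+ 2.
have WW j j' : (W^T *m W) j j' = (j == j')%:R * nu m j.
  rewrite mxE; under eq_bigr do rewrite !mxE.
  have [<-|jj'] := eqVneq j j'; last first.
    rewrite mul0r big1// => k _; have [kj|] := eqVneq (k : nat) j.
      by rewrite kj val_eqE (negPf jj') !mul0r mulr0.
    by rewrite !mul0r.
  rewrite mul1r /nu; have [jm|jm] := ltnP j m; last first.
    rewrite mul0r big1// => k _; rewrite (_ : _ == _ = false) ?mul0r//.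
    by apply/negbTE; rewrite neq_ltn (leq_trans _ jm).
  rewrite (bigD1 (Ordinal jm))//= eqxx big1 ?addr0 ?mul1r ?expr2// => k kj.
  by rewrite (_ : _ == _ = false) ?mul0r//; apply/negbTE.
have WW' i i' : (W *m W^T) i i' = (i == i')%:R * nu n i.
  rewrite mxE; under eq_bigr do rewrite !mxE.
  have [<-|ii'] := eqVneq i i'; last first.
    rewrite mul0r big1// => k _; have [ik|] := eqVneq (i : nat) k.
      by rewrite -ik eq_sym val_eqE (negPf ii') mul0r mulr0.
    by rewrite !mul0r.
  rewrite mul1r /nu; have [im|im] := ltnP i n; last first.
    rewrite mul0r big1// => k _; rewrite (_ : _ == _ = false) ?mul0r//.
    by apply/negbTE; rewrite neq_ltn (leq_trans _ im) ?orbT.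
  rewrite (bigD1 (Ordinal im))//= eqxx big1 ?addr0 ?mul1r ?expr2// => k ki.
  by rewrite (_ : _ == _ = false) ?mul0r//; apply/negbTE; rewrite eq_sym.
have DWW : D *m (W^T *m W) = (W *m W^T) *m D.
  by rewrite mulmxA -DW -mulmxA -WD mulmxA.
move=> i j ij.
have DWE : (D *m (W^T *m W)) i j = D i j * nu m j.
  rewrite mxE (bigD1 j)//= WW eqxx mul1r big1 ?addr0// => k kj.
  by rewrite WW (negPf kj) mul0r mulr0.
have WDE : (W *m W^T *m D) i j = nu n i * D i j.
  rewrite mxE (bigD1 i)//= WW' eqxx mul1r big1 ?addr0// => k ki.
  by rewrite WW' eq_sym (negPf ki) !mul0r.
move: DWE; rewrite DWW WDE => /esym.
rewrite mulrC => /eqP; rewrite -subr_eq0 -mulrBl mulf_eq0 => /orP[|/eqP//].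
rewrite /nu subr_eq0.
have sq k : k.+1%:R ^+ 2 != 0 :> R by rewrite sqrf_eq0 pnatr_eq0.
have [jm|jm] := ltnP j m; have [im|im] := ltnP i n; rewrite ?mul1r ?mul0r.
- by rewrite eqrXn2 ?ler0n// eqr_nat eqSS eq_sym (negPf ij).
- by rewrite (negPf (sq _)).
- by rewrite eq_sym (negPf (sq _)).
- by have := leq_trans (leq_ltn_trans jm (ltn_ord j)) im; rewrite ltnNge ltnW.
Qed.

Lemma colsub_orthonormal (R : realType) (m r : nat) (U : 'M[R]_m)
    (f : 'I_r -> 'I_m) :
  U^T *m U = 1%:M -> injective f ->
  (colsub f U)^T *m colsub f U = 1%:M.
Proof.
move=> UU finj; apply/matrixP => k l; rewrite !mxE.
have /matrixP/(_ (f k) (f l)) := UU; rewrite !mxE (inj_eq finj) => <-.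
by apply: eq_bigr => i _; rewrite !mxE.
Qed.

Lemma mul_colsub_diag (R : realType) (m n r : nat) (U : 'M[R]_m)
    (V : 'M[R]_n) (f : 'I_r -> 'I_m) (g : 'I_r -> 'I_n) (d : 'rV[R]_r) :
  colsub f U *m diag_mx d *m (colsub g V)^T =
  \sum_k d 0 k *: (col (f k) U *m (col (g k) V)^T).
Proof.
apply/matrixP => i j; rewrite mul_mx_diag !mxE summxE; apply: eq_bigr => k _.
rewrite !mxE big_ord1 !mxE; ring.
Qed.

Lemma mxrank_orthonormal_mul (R : realType) (m n r : nat) (U : 'M[R]_(m, r))
    (S : 'M[R]_r) (V : 'M[R]_(n, r)) :
  U^T *m U = 1%:M -> V^T *m V = 1%:M -> S \in unitmx ->
  \rank (U *m S *m V^T) = r.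
Proof.
move=> UU VV Su; rewrite mxrankMfree; last by apply/row_freeP; exists V.
rewrite -mxrank_tr trmx_mul mxrankMfree; last by apply/row_freeP; exists U.
by rewrite mxrank_tr mxrank_unit.
Qed.

Lemma diag_unitmx (R : realType) (r : nat) (d : 'rV[R]_r) :
  (forall k, d 0 k != 0) -> diag_mx d \in unitmx.
Proof.
move=> d0; rewrite unitmxE det_diag unitfE.
by apply/prodf_neq0 => k _.
Qed.

(** The singular vectors are kept as columns of two full orthogonal matrices
    selected by [f] and [g], so that directions of singular value zero remain
    available for exchange.  The singular values [d] carry signs. *)
Lemma svd_thin (R : realType) (m n r : nat) (Y : 'M[R]_(m, n)) :
  \rank Y = r ->
  exists U : 'M[R]_m, exists V : 'M[R]_n,
  exists f : 'I_r -> 'I_m, exists g : 'I_r -> 'I_n, exists d : 'rV[R]_r,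
    [/\ U^T *m U = 1%:M /\ V^T *m V = 1%:M, injective f, injective g,
        forall k, d 0 k != 0 &
        Y = colsub f U *m diag_mx d *m (colsub g V)^T].
Proof.
move=> Yr; have [U [V [UU VV]]] := svd_full Y.
set D := U^T *m Y *m V => Ddiag.
have YD : Y = U *m D *m V^T.
  have UU' := mulmx1C UU; have VV' := mulmx1C VV.
  by rewrite /D !mulmxA UU' mul1mx -mulmxA VV' mulmx1.
pose P := [set p : 'I_m * 'I_n | D p.1 p.2 != 0]%SET.
pose f (k : 'I_#|P|) := (enum_val k).1; pose g (k : 'I_#|P|) := (enum_val k).2.
pose d : 'rV[R]_#|P| := \row_k D (f k) (g k).
have d0 k : d 0 k != 0.
  by rewrite mxE; have := enum_valP k; rewrite inE.
have fg k : f k = g k :> nat.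
  by apply/eqP; apply: contraNT (d0 k) => /Ddiag dk; rewrite mxE dk.
have finj : injective f.
  move=> k l fkl; apply: enum_val_inj; rewrite [LHS]surjective_pairing.
  rewrite [RHS]surjective_pairing -/(f k) -/(f l) fkl; congr (_, _).
  by apply: val_inj; rewrite /= -/(g k) -/(g l) -!fg fkl.
have ginj : injective g.
  by move=> k l gkl; apply: finj; apply: val_inj; rewrite /= !fg gkl.
have Yd : Y = colsub f U *m diag_mx d *m (colsub g V)^T.
  rewrite mul_colsub_diag YD.
  rewrite (eq_bigr (fun k : 'I_#|P| => D (enum_val k).1 (enum_val k).2 *:
     (col (enum_val k).1 U *m (col (enum_val k).2 V)^T))); last first.
    by move=> k _; rewrite mxE.
  rewrite -(big_enum_val (fun p : 'I_m * 'I_n =>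
     D p.1 p.2 *: (col p.1 U *m (col p.2 V)^T))).
  rewrite big_mkcond /=.
  rewrite (eq_bigr (fun p : 'I_m * 'I_n =>
     D p.1 p.2 *: (col p.1 U *m (col p.2 V)^T))); last first.
    move=> p _; rewrite inE; case: ifPn => //; rewrite negbK => /eqP->.
    by rewrite scale0r.
  rewrite -(pair_bigA _ (fun i j => D i j *: (col i U *m (col j V)^T)))/=.
  apply/matrixP => a b; rewrite mxE summxE.
  under eq_bigr do rewrite mxE mulr_suml.
  rewrite exchange_big; apply: eq_bigr => i _; rewrite summxE.
  apply: eq_bigr => j _; rewrite !mxE big_ord1 !mxE; ring.
have Pr : #|P| = r.
  rewrite -Yr Yd mxrank_orthonormal_mul//; first exact: colsub_orthonormal.
    exact: colsub_orthonormal.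
  exact: diag_unitmx.
by case: _ / Pr in f g d d0 fg finj ginj Yd *; exists U, V, f, g, d.
Qed.

(** * Splitting the vector field at a rank-r matrix *)

Lemma col_orthonormal (R : realType) (m : nat) (U : 'M[R]_m) i :
  U^T *m U = 1%:M -> (col i U)^T *m col i U = 1%:M.
Proof.
move=> UU; apply/matrixP => a b; rewrite !ord1 !mxE.
have /matrixP/(_ i i) := UU; rewrite !mxE eqxx => <-.
by apply: eq_bigr => k _; rewrite !mxE.
Qed.

Lemma frob_col (R : realType) (m : nat) (U : 'M[R]_m) i :
  U^T *m U = 1%:M -> frob_norm (col i U) = 1.
Proof.
move=> UU; rewrite -[col i U]mulmx1 frob_isol ?col_orthonormal//.
by rewrite frob_normE /mxdot trmx1 mulmx1 mxtrace1 sqrtr1.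
Qed.

Lemma exists_notin_codom (r m : nat) (f : 'I_r -> 'I_m) :
  (r < m)%N -> exists a, forall k, f k != a.
Proof.
move=> rm; have [/existsP[a /forallP fa]|/existsPn h] :=
  boolP [exists a, [forall k, f k != a]]; first by exists a.
have : (#|'I_m| <= #|codom f|)%N.
  apply/subset_leq_card/fintype.subsetP => a _; have := h a.
  by rewrite negb_forall => /existsP[k /negPn/eqP <-]; exact: codom_f.
by rewrite card_ord leqNgt (leq_ltn_trans (leq_image_card _ _))// card_ord.
Qed.

Lemma colsub_perp (R : realType) (m r : nat) (U : 'M[R]_m)
    (f : 'I_r -> 'I_m) i :
  U^T *m U = 1%:M -> (forall k, f k != i) -> (col i U)^T *m colsub f U = 0.
Proof.
move=> UU fi; apply/matrixP => a k; rewrite !mxE.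
have /matrixP/(_ i (f k)) := UU; rewrite !mxE eq_sym (negPf (fi k)) mulr0n => h.
rewrite -[RHS]h.
by apply: eq_bigr => l _; rewrite !mxE.
Qed.

(** The absolute singular value attached to the [i]-th singular direction, and
    zero when that direction is not selected by [f]. *)
Definition dir_weight (R : realType) (r p : nat) (d : 'rV[R]_r)
    (f : 'I_r -> 'I_p) (i : 'I_p) : R :=
  \sum_k `|d 0 k| * (f k == i)%:R.

Lemma dir_weight_ge0 (R : realType) (r p : nat) (d : 'rV[R]_r)
    (f : 'I_r -> 'I_p) i :
  0 <= dir_weight d f i.
Proof. by apply: sumr_ge0 => k _; rewrite mulr_ge0. Qed.

(** Exchange [u_i] and [v_j] with unselected directions [u_a] and [v_b].  This
    gives a rank-[r] matrix [Z] at distance at most twice the weights of [i]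
    and [j], and the hypothesis on the normal component at [Z] bounds the
    [(i, j)] entry of [F Z], because [u_i] and [v_j] are orthogonal to the
    column and row spaces of [Z]. *)
Lemma entry_bound (R : realType) (m n r : nat) (L eps : R)
    (F : 'M[R]_(m, n) -> 'M[R]_(m, n)) (U : 'M[R]_m) (V : 'M[R]_n)
    (f : 'I_r -> 'I_m) (g : 'I_r -> 'I_n) (d : 'rV[R]_r) :
  (r < m)%N -> (r < n)%N -> 0 <= L ->
  (forall X Z, frob_norm (F X - F Z) <= L * frob_norm (X - Z)) ->
  (forall (U : 'M[R]_(m, r)) (S : 'M[R]_r) (V : 'M[R]_(n, r)),
      U^T *m U = 1%:M -> V^T *m V = 1%:M -> S \in unitmx ->
      frob_norm ((1%:M - U *m U^T) *m F (U *m S *m V^T)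
                 *m (1%:M - V *m V^T)) <= eps) ->
  U^T *m U = 1%:M -> V^T *m V = 1%:M -> injective f -> injective g ->
  (forall k, d 0 k != 0) ->
  forall i j,
  `|(U^T *m F (colsub f U *m diag_mx d *m (colsub g V)^T) *m V) i j|
    <= eps + L * (2 * (dir_weight d f i + dir_weight d g j)).
Proof.
move=> rm rn L0 Flip Fnorm UU VV finj ginj d0 i j.
have [a fa] := exists_notin_codom f rm.
have [b gb] := exists_notin_codom g rn.
pose f' k := tperm i a (f k); pose g' k := tperm j b (g k).
have f'inj : injective f' by move=> k l /perm_inj/finj.
have g'inj : injective g' by move=> k l /perm_inj/ginj.
have f'i k : f' k != i.
  by rewrite -[X in _ != X](tpermR i a) (inj_eq perm_inj).
have g'j k : g' k != j.
  by rewrite -[X in _ != X](tpermR j b) (inj_eq perm_inj).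
set Y := colsub f U *m _ *m _.
set Z := colsub f' U *m diag_mx d *m (colsub g' V)^T.
set x := col i U; set y := col j V.
have xx : x^T *m x = 1%:M by exact: col_orthonormal.
have yy : y^T *m y = 1%:M by exact: col_orthonormal.
have entE (M : 'M[R]_(m, n)) : (U^T *m M *m V) i j = (x^T *m M *m y) 0 0.
  rewrite !mxE; apply: eq_bigr => k _; rewrite !mxE; congr (_ * _).
  by apply: eq_bigr => l _; rewrite !mxE.
have ent_le (M : 'M[R]_(m, n)) : `|(x^T *m M *m y) 0 0| <= frob_norm M.
  rewrite (le_trans (le_entry_frob _ _ _))// (le_trans (frob_coisor _ yy))//.
  exact: frob_coisol.
have FZ : `|(x^T *m F Z *m y) 0 0| <= eps.
  have xU : x^T *m colsub f' U = 0 by exact: colsub_perp.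
  have Vy : (colsub g' V)^T *m y = 0.
    by rewrite -[LHS]trmxK trmx_mul trmxK colsub_perp ?trmx0.
  apply: le_trans (Fnorm (colsub f' U) (diag_mx d) (colsub g' V) _ _ _).
  - rewrite -/Z; set E := (_ - _) *m _ *m _.
    suff -> : x^T *m F Z *m y = x^T *m E *m y by exact: ent_le.
    have xP : x^T *m (1%:M - colsub f' U *m (colsub f' U)^T) = x^T.
      by rewrite mulmxBr mulmx1 mulmxA xU mul0mx subr0.
    have Py : (1%:M - colsub g' V *m (colsub g' V)^T) *m y = y.
      by rewrite mulmxBl mul1mx -mulmxA Vy mulmx0 subr0.
    by rewrite /E !mulmxA xP -[RHS]mulmxA Py.
  - exact: colsub_orthonormal.
  - exact: colsub_orthonormal.
  - exact: diag_unitmx.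
have YZ : frob_norm (Y - Z) <= 2 * (dir_weight d f i + dir_weight d g j).
  rewrite /Y /Z !mul_colsub_diag -sumrB (le_trans (frob_sum _))//.
  rewrite /dir_weight -big_split mulr_sumr/=; apply: ler_sum => k _.
  rewrite -scalerBr frobZ -mulrDr mulrCA ler_wpM2l//.
  have uv i' j' : frob_norm (col i' U *m (col j' V)^T) <= 1.
    by rewrite (le_trans (frob_mul _ _))// frob_tr !frob_col// mulr1.
  have two : frob_norm (col (f k) U *m (col (g k) V)^T -
      col (f' k) U *m (col (g' k) V)^T) <= 2.
    by rewrite (le_trans (frobD _ _))// frobN (natrD _ 1 1) lerD.
  have [fki|fki] := eqVneq (f k) i.
    by rewrite (le_trans two)// mulrDr mulr1 lerDl mulr_ge0.
  have [gkj|gkj] := eqVneq (g k) j; first by rewrite add0r mulr1.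
  rewrite /f' /g' !tpermD 1?eq_sym ?fki ?gkj ?fa ?gb// 1?eq_sym ?fa ?gb//.
    by rewrite subrr frob0 addr0 mulr0.
rewrite entE -[F Y](subrK (F Z)) addrC mulmxDr mulmxDl mxE.
rewrite (le_trans (ler_normD _ _))// lerD//.
rewrite (le_trans (ent_le _))// (le_trans (Flip _ _))//.
by rewrite ler_wpM2l.
Qed.

(** For the left singular vectors and the singular values of a matrix [Y], this
    is the square root of [Y *m Y^T]: it links [Y] to the weights. *)
Lemma diag_dir_weight (R : realType) (r p : nat) (U : 'M[R]_p) (d : 'rV[R]_r)
    (f : 'I_r -> 'I_p) :
  colsub f U *m diag_mx (\row_k `|d 0 k|) *m (colsub f U)^T =
  U *m diag_mx (\row_i dir_weight d f i) *m U^T.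
Proof.
apply/matrixP => a b; rewrite !mxE.
under eq_bigr do rewrite mul_mx_diag !mxE.
under [RHS]eq_bigr do rewrite mul_mx_diag !mxE /dir_weight mulr_sumr mulr_suml.
rewrite exchange_big; apply: eq_bigr => k _.
rewrite (bigD1 (f k))//= eqxx mulr1 big1 ?addr0// => i ik.
by rewrite eq_sym (negPf ik) !(mulr0, mul0r).
Qed.

(** For the singular vectors and signed singular values of a matrix [Y], the
    factor applied to [A] is the partial isometry whose product with [Y] is the
    square root of [Y *m Y^T]. *)
Lemma frob_mulldiag_sgr (R : realType) (m n r : nat) (V : 'M[R]_(n, r))
    (U : 'M[R]_(m, r)) (d : 'rV[R]_r) p (A : 'M[R]_(m, p)) :
  U^T *m U = 1%:M -> V^T *m V = 1%:M -> (forall k, d 0 k != 0) ->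
  frob_norm (V *m diag_mx (\row_k Num.sg (d 0 k)) *m U^T *m A) <= frob_norm A.
Proof.
move=> UU VV d0; rewrite -!mulmxA frob_isol// frob_isol ?frob_coisol//.
apply/matrixP => i j; rewrite tr_diag_mx mul_mx_diag !mxE.
by case: eqVneq => [<-|_]; rewrite ?mulr1n ?mulr0n ?mul0r// -expr2 sqr_sg d0.
Qed.

(** In singular bases, [H] is the matrix with entries
    [c * Fh / (eps + c * tau)], bounded by [c]; the approximation of [F Y] has
    entries [H i j * tau i j], where [tau i j] is a row weight plus a column
    weight.  The row part is [Y *m W *m K] and the column part [K *m W *m Y],
    with [K] the matrix [H] in the original bases and [W] a partial isometry.
    The error is at most [eps] in every entry, and at most [e1 < eps] in the
    entry of a singular value not below [mu / r]; this makes [eta] strictly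
    smaller than [sqrt (m * n) * eps], with a gap that depends on [F] and [Y]
    only through [L], [eps] and the lower bound [mu]. *)
Lemma tangent_split (R : realType) (m n r : nat) (L eps mu : R) :
  (0 < r)%N -> (r < m)%N -> (r < n)%N -> 0 <= L -> 0 < eps -> 0 < mu ->
  exists2 eta : R, 0 <= eta < Num.sqrt (m * n)%:R * eps &
  forall F : 'M[R]_(m, n) -> 'M[R]_(m, n),
  (forall X Z, frob_norm (F X - F Z) <= L * frob_norm (X - Z)) ->
  (forall (U : 'M[R]_(m, r)) (S : 'M[R]_r) (V : 'M[R]_(n, r)),
      U^T *m U = 1%:M -> V^T *m V = 1%:M -> S \in unitmx ->
      frob_norm ((1%:M - U *m U^T) *m F (U *m S *m V^T)
                 *m (1%:M - V *m V^T)) <= eps) ->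
  forall Y : 'M[R]_(m, n), \rank Y = r -> mu <= frob_norm Y ->
  exists M : 'M[R]_m, exists N : 'M[R]_n,
    [/\ frob_norm M <= (m * n)%:R * (2 * L + 1),
        frob_norm N <= (m * n)%:R * (2 * L + 1) &
        frob_norm (F Y - (M *m Y + Y *m N)) <= eta].
Proof.
move=> r0 rm rn L0 e0 mu0; set c := 2 * L + 1.
have c0 : 0 < c by rewrite ltr_wpDl// mulr_ge0.
pose nu := mu / r%:R.
have nu0 : 0 < nu by rewrite divr_gt0// ltr0n.
pose e1 := eps * ((eps + 2 * L * nu) / (eps + c * nu)).
have e1e : 0 <= e1 < eps.
  have q0 : 0 < eps + c * nu by rewrite addr_gt0// mulr_gt0.
  have p0 : 0 <= eps + 2 * L * nu.
    by rewrite addr_ge0 ?(ltW e0)// mulr_ge0 ?(ltW nu0)// mulr_ge0.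
  rewrite mulr_ge0 ?(ltW e0) ?divr_ge0 ?(ltW q0)//=.
  rewrite gtr_pMr// ltr_pdivrMr// mul1r ltrD2l ltr_pM2r//.
  by rewrite /c ltrDl.
case/andP: e1e => e10 e1e.
have mn0 : (0 < m * n)%N.
  by rewrite muln_gt0 (leq_trans _ rm)// (leq_trans _ rn).
exists (Num.sqrt ((m * n)%:R * eps ^+ 2 - (eps ^+ 2 - e1 ^+ 2))).
  have -> : Num.sqrt (m * n)%:R * eps = Num.sqrt ((m * n)%:R * eps ^+ 2).
    by rewrite sqrtrM// sqrtr_sqr gtr0_norm.
  rewrite sqrtr_ge0 /= ltr_sqrt ?mulr_gt0 ?ltr0n ?exprn_gt0// gtrBl subr_gt0.
  by rewrite ltr_pXn2r ?nnegrE// ltW.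
move=> F Flip Fnorm Y Yr Ymu.
have [U [V [f [g [d [[UU VV] finj ginj d0 YE]]]]]] := svd_thin Yr.
have := entry_bound rm rn L0 Flip Fnorm UU VV finj ginj d0.
rewrite -YE; set Fh := U^T *m F Y *m V.
pose tau i j := dir_weight d f i + dir_weight d g j.
have tau0 i j : 0 <= tau i j by rewrite addr_ge0 ?dir_weight_ge0.
have den i j : 0 < eps + c * tau i j by rewrite ltr_wpDr// mulr_ge0// ltW.
move=> Fhle; pose H : 'M[R]_(m, n) :=
  \matrix_(i, j) (c * Fh i j / (eps + c * tau i j)).
have UU' := mulmx1C UU; have VV' := mulmx1C VV.
have FYE : F Y = U *m Fh *m V^T.
  by rewrite /Fh !mulmxA UU' mul1mx -mulmxA VV' mulmx1.
clearbody Fh.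
have Hle : frob_norm H <= (m * n)%:R * c.
  apply: frob_bound => i j; rewrite mxE !normrM gtr0_norm// -mulrA ger_pMr//.
  rewrite normfV (gtr0_norm (den i j)) ler_pdivrMr// mul1r.
  rewrite (le_trans (Fhle i j))// lerD2l -/(tau i j) mulrA ler_wpM2r// /c.
  lra.
pose K := U *m H *m V^T.
have Kle : frob_norm K <= (m * n)%:R * c by rewrite frob_isor// frob_isol.
pose W := colsub g V *m diag_mx (\row_k Num.sg (d 0 k)) *m (colsub f U)^T.
have fU : (colsub f U)^T *m colsub f U = 1%:M by exact: colsub_orthonormal.
have gV : (colsub g V)^T *m colsub g V = 1%:M by exact: colsub_orthonormal.
have dsg : diag_mx d *m diag_mx (\row_k Num.sg (d 0 k)) =
    diag_mx (\row_k `|d 0 k|).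
  apply/matrixP => k l; rewrite mul_mx_diag !mxE.
  have [<-|_] := eqVneq k l; rewrite ?mulr1n ?mulr0n ?mul0r//.
  by rewrite mulrC normrEsg.
have sgd : diag_mx (\row_k Num.sg (d 0 k)) *m diag_mx d =
    diag_mx (\row_k `|d 0 k|) by rewrite diag_mxC.
have YW : Y *m W = U *m diag_mx (\row_i dir_weight d f i) *m U^T.
  rewrite YE /W !mulmxA -[_ *m (colsub g V)^T *m _]mulmxA gV mulmx1.
  by rewrite -[_ *m diag_mx d *m _]mulmxA dsg diag_dir_weight.
have WY : W *m Y = V *m diag_mx (\row_i dir_weight d g i) *m V^T.
  rewrite YE /W !mulmxA -[_ *m (colsub f U)^T *m _]mulmxA fU mulmx1.
  by rewrite -[_ *m diag_mx d]mulmxA sgd diag_dir_weight.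
exists (K *m W), (W *m K); split.
- apply: le_trans Kle; rewrite -frob_tr trmx_mul -(frob_tr K).
  have -> : W^T = colsub f U *m diag_mx (\row_k Num.sg (d 0 k)) *m
      (colsub g V)^T by rewrite /W !trmx_mul trmxK tr_diag_mx mulmxA.
  exact: frob_mulldiag_sgr.
- by apply: le_trans Kle; exact: frob_mulldiag_sgr.
have -> : F Y - (K *m W *m Y + Y *m (W *m K)) = U *m
    (\matrix_(i, j) (Fh i j * (eps / (eps + c * tau i j)))) *m V^T.
  rewrite FYE.
  rewrite -(mulmxA K W Y) WY (mulmxA Y W K) YW /K.
  rewrite !mulmxA -[_ *m V^T *m V]mulmxA VV mulmx1.
  rewrite -[_ *m U^T *m U]mulmxA UU mulmx1.
  rewrite -mulmxDl -mulmxBl; congr (_ *m _).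
  rewrite -!mulmxA -mulmxDr -mulmxBr; congr (_ *m _).
  apply/matrixP => i j; rewrite mul_mx_diag mul_diag_mx !mxE.
  rewrite /tau; field.
  by rewrite gt_eqF// den.
rewrite frob_isor// frob_isol//.
set E := \matrix_(i, j) _.
have Ele i j :
    `|E i j| <= eps * ((eps + 2 * L * tau i j) / (eps + c * tau i j)).
  rewrite mxE normrM normrM normfV (gtr0_norm e0) (gtr0_norm (den i j)).
  rewrite mulrCA ler_wpM2l ?(ltW e0)// ler_wpM2r ?invr_ge0 ?(ltW (den i j))//.
  by rewrite (le_trans (Fhle i j))// mulrA -/(tau i j) [L * 2]mulrC.
have Ele_eps i j : `|E i j| <= eps.
  rewrite (le_trans (Ele i j))// ger_pMr// ler_pdivrMr// mul1r lerD2l.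
  by rewrite ler_wpM2r// /c lerDl.
(* The norm of [Y] is at most the sum of its [r] singular values. *)
have [k dk] : exists k, nu <= `|d 0 k|.
  apply/not_existsP => dnu; move: Ymu; apply/negP; rewrite -ltNge.
  rewrite YE mul_colsub_diag (le_lt_trans (frob_sum _))//.
  apply: (@le_lt_trans _ _ (\sum_k `|d 0 k|)).
    apply: ler_sum => k _; rewrite frobZ ler_piMr//.
    by rewrite (le_trans (frob_mul _ _))// frob_tr !frob_col// mulr1.
  apply: (@lt_le_trans _ _ (\sum_(k < r) nu)).
    apply: ltr_sum => [|k _]; first by apply/hasP; exists (Ordinal r0).
    by rewrite ltNge; apply/negP/dnu.
  by rewrite sumr_const card_ord -mulr_natr divfK// pnatr_eq0 -lt0n.
have tauk : nu <= tau (f k) (g k).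
  rewrite ler_wpDr ?dir_weight_ge0// (le_trans dk)// /dir_weight.
  rewrite (bigD1 k)//= eqxx mulr1 lerDl.
  by apply: sumr_ge0 => l _; rewrite mulr_ge0.
have Ek : `|E (f k) (g k)| <= e1.
  rewrite (le_trans (Ele _ _))// ler_wpM2l ?(ltW e0)//.
  rewrite ler_pdivrMr// [leRHS]mulrAC ler_pdivlMr; last first.
    by rewrite addr_gt0// mulr_gt0.
  have := tau0 (f k) (g k); move: (tau (f k) (g k)) tauk => t nut t0.
  have : 0 <= eps * (t - nu) by rewrite mulr_ge0 ?subr_ge0// ltW.
  rewrite /c; nra.
have sqle i j : E i j ^+ 2 <= eps ^+ 2.
  by rewrite -real_normK ?num_real// ler_pXn2r ?nnegrE// ltW.
rewrite /frob_norm; apply: ler_wsqrtr; rewrite pair_bigA/=.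
have tot : \sum_(p : 'I_m * 'I_n) eps ^+ 2 = (m * n)%:R * eps ^+ 2.
  by rewrite sumr_const card_prod !card_ord mulr_natl.
rewrite -tot !(bigD1 (f k, g k) (P := xpredT))//= opprB addrA.
have rest : \sum_(p | p != (f k, g k)) E p.1 p.2 ^+ 2 <=
    \sum_(p : 'I_m * 'I_n | p != (f k, g k)) eps ^+ 2.
  by apply: ler_sum => p _; exact: sqle.
have : E (f k) (g k) ^+ 2 <= e1 ^+ 2.
  by rewrite -[leLHS]real_normK ?num_real// ler_pXn2r ?nnegrE.
move: rest; lra.
Qed.

(** * Multiplication by near-identity factors *)

Definition near_id (R : realType) (p : nat) (X : 'M[R]_p) : Prop :=
  frob_norm (X - 1%:M) <= 2^-1.

Definition near_equiv (R : realType) (m n : nat) (Y0 Y : 'M[R]_(m, n)) : Prop :=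
  exists Phi Psi, [/\ near_id Phi, near_id Psi & Y = Phi *m Y0 *m Psi].

Lemma near_id_mull (R : realType) (p q : nat) (X : 'M[R]_p) (A : 'M[R]_(p, q)) :
  near_id X -> frob_norm (X *m A) <= 3 / 2 * frob_norm A /\
               frob_norm A <= 2 * frob_norm (X *m A).
Proof.
move=> X1; set a := frob_norm A; set b := frob_norm (X *m A).
have E : frob_norm ((X - 1%:M) *m A) <= 2^-1 * a by apply: frob_mulW.
have h1 : b <= frob_norm ((X - 1%:M) *m A) + a.
  by rewrite (le_trans _ (frobD _ _))// mulmxBl mul1mx subrK.
have h2 : a <= b + frob_norm ((X - 1%:M) *m A).
  rewrite -(frobN ((X - 1%:M) *m A)) (le_trans _ (frobD _ _))//.
  by rewrite mulmxBl mul1mx opprB addrC subrK.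
split; lra.
Qed.

Lemma near_id_tr (R : realType) (p : nat) (X : 'M[R]_p) :
  near_id X -> near_id X^T.
Proof. by rewrite /near_id -trmx1 -linearB /= frob_tr trmx1. Qed.

Lemma near_id_mulr (R : realType) (p q : nat) (X : 'M[R]_p) (A : 'M[R]_(q, p)) :
  near_id X -> frob_norm (A *m X) <= 3 / 2 * frob_norm A /\
               frob_norm A <= 2 * frob_norm (A *m X).
Proof.
move=> /near_id_tr/(near_id_mull A^T).
by rewrite -trmx_mul !frob_tr.
Qed.

Lemma near_id_unit (R : realType) (p : nat) (X : 'M[R]_p) :
  near_id X -> X \in unitmx.
Proof.
move=> X1; rewrite -row_free_unit; apply: inj_row_free => v vX.
have [_] := near_id_mulr v X1; rewrite vX frob0 mulr0 => v0.
by apply: frob_eq0; apply/eqP; rewrite eq_le v0 frob_ge0.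
Qed.

Lemma near_equiv_rank (R : realType) (m n : nat) (Y0 Y : 'M[R]_(m, n)) :
  near_equiv Y0 Y -> \rank Y = \rank Y0.
Proof.
move=> [Phi [Psi [/near_id_unit Phiu /near_id_unit Psiu ->]]].
rewrite mxrankMfree ?row_free_unit// -mxrank_tr trmx_mul.
by rewrite mxrankMfree ?row_free_unit ?unitmx_tr// mxrank_tr.
Qed.

Lemma near_equiv_frob (R : realType) (m n : nat) (Y0 Y : 'M[R]_(m, n)) :
  near_equiv Y0 Y ->
  frob_norm Y <= 9 / 4 * frob_norm Y0 /\ frob_norm Y0 <= 4 * frob_norm Y.
Proof.
move=> [Phi [Psi [Phi1 Psi1 ->]]].
have := near_id_mull Y0 Phi1; have := near_id_mulr (Phi *m Y0) Psi1; lra.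
Qed.

(** [Q] is [(V^T Psi V)^-1 V^T Psi].  The matrix [V^T Psi V] is again near the
    identity, so its inverse has norm at most 2, and [Psi] has norm at most
    3/2. *)
Lemma near_equiv_graph (R : realType) (m n r : nat) (Y0 Y : 'M[R]_(m, n))
    (V : 'M[R]_(n, r)) :
  V^T *m V = 1%:M -> Y0 = Y0 *m V *m V^T -> near_equiv Y0 Y ->
  exists2 Q : 'M[R]_(r, n), Y = (Y *m V) *m Q & op_norm Q <= 3.
Proof.
move=> VV YV [Phi [Psi [Phi1 Psi1 ->]]].
pose G := V^T *m Psi *m V.
have G1 : near_id G.
  rewrite /near_id /G.
  have -> : V^T *m Psi *m V - 1%:M = V^T *m (Psi - 1%:M) *m V.
    by rewrite mulmxBr mulmxBl mulmx1 VV.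
  by rewrite (le_trans (frob_coisor _ VV))// (le_trans (frob_coisol _ VV)).
have Gu := near_id_unit G1.
exists (invmx G *m (V^T *m Psi)).
  rewrite [in RHS]YV.
  have -> : Phi *m (Y0 *m V *m V^T) *m Psi *m V = Phi *m Y0 *m V *m G.
    by rewrite /G !mulmxA.
  by rewrite mulmxA mulmxK// {1}YV !mulmxA.
apply: sup_le_ub.
  exists (frob_norm (invmx G *m (V^T *m Psi) *m (0 : 'cV[R]_n))).
  by exists 0 => //=; rewrite frob0.
move=> _ [x /= x1 <-]; set z := _ *m x.
have [_ h1] := near_id_mull z G1.
have Gz : G *m z = V^T *m (Psi *m x) by rewrite /z mulmxA mulKVmx// -mulmxA.
have h2 : frob_norm (G *m z) <= frob_norm (Psi *m x).
  by rewrite Gz frob_coisol.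
have [h3 _] := near_id_mull x Psi1.
by move: h1 h2 h3 x1; lra.
Qed.

(** The distance from [A] to [Phi *m Y0 *m Psi] attains its minimum on the
    compact set of pairs of factors, and the hypothesis makes this minimum
    zero. *)
Lemma near_equiv_closed (R : realType) (m n : nat) (Y0 A : 'M[R]_(m, n)) :
  (forall e : R, 0 < e -> exists2 Y, near_equiv Y0 Y & frob_norm (Y - A) < e) ->
  near_equiv Y0 A.
Proof.
move=> Aclose.
pose K : set ('M[R]_m * 'M[R]_n) := [set P | near_id P] `*` [set P | near_id P].
pose f (p : 'M[R]_m * 'M[R]_n) := frob_norm (p.1 *m Y0 *m p.2 - A).
have cK : compact K by apply: compact_setX; exact: compact_frob_ball.
have K0 : K !=set0.
  exists (1%:M, 1%:M); split; rewrite /= /near_id subrr frob0 invr_ge0//.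
have cf : {within K, continuous f}.
  apply: continuous_subspaceT => p.
  apply: (@cvg_frob _ _ _ _ (nbhs p) _
    (fun p : 'M[R]_m * 'M[R]_n => p.1 *m Y0 *m p.2 - A)).
  apply: cvgB; last exact: cvg_cst.
  apply: (@cvg_mulmx _ _ _ _ _ (nbhs p)); last exact: cvg_snd.
  apply: (@cvg_mulmx _ _ _ _ _ (nbhs p)); last exact: cvg_cst.
  exact: cvg_fst.
have [[Phi Psi]] := compact_EVT_min K0 cK cf.
rewrite inE => -[/= Phi1 Psi1] fmin.
exists Phi, Psi; split=> //; apply/esym/eqP; rewrite -subr_eq0; apply/eqP.
apply: frob_eq0; apply/eqP; rewrite eq_le frob_ge0 andbT leNgt; apply/negP.
move=> /Aclose[Y [Phi' [Psi' [Phi1' Psi1' ->]]]]; apply/negP; rewrite -leNgt.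
by apply: (fmin (Phi', Psi')); rewrite inE.
Qed.

(** * Derivatives of matrix curves and a Gronwall estimate *)

Lemma is_derive_entry (R : realType) (m n : nat) (f : R -> 'M[R]_(m, n)) (s : R)
    (df : 'M[R]_(m, n)) i j :
  is_derive s 1 f df -> is_derive s 1 (fun x => f x i j) (df i j).
Proof.
move=> [fs <-]; have fij := (derivable_mxP f s 1).1 fs i j.
by apply: DeriveDef => //; rewrite derive_mx// mxE.
Qed.

Lemma is_derive_mxdot (R : realType) (m n : nat) (f g : R -> 'M[R]_(m, n))
    (s : R)    (df dg : 'M[R]_(m, n)) :
  is_derive s 1 f df -> is_derive s 1 g dg ->
  is_derive s 1 (fun x => mxdot (f x) (g x)) (mxdot (f s) dg + mxdot df (g s)).
Proof.
move=> fs gs.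
have -> : (fun x => mxdot (f x) (g x)) =
    \sum_i \sum_j ((fun x => f x i j) * (fun x => g x i j)).
  apply/funext => x; rewrite mxdotE fct_sumE; apply: eq_bigr => i _.
  by rewrite fct_sumE.
have -> : mxdot (f s) dg + mxdot df (g s) =
    \sum_i \sum_j (f s i j *: dg i j + g s i j *: df i j).
  rewrite !mxdotE -big_split; apply: eq_bigr => i _.
  rewrite -big_split; apply: eq_bigr => j _ /=.
  by rewrite [df i j * _]mulrC.
apply: is_derive_sum => i; apply: is_derive_sum => j.
by apply: is_deriveM; exact: is_derive_entry.
Qed.

(** The norm is not differentiable at zero, so it is replaced by the smooth
    majorant [q = sqrt (|f|^2 + del^2)], for which [expR (- L * s) * q s -
    kap * s] is nonincreasing; then [del] tends to zero. *)
Lemma gronwall (R : realType) (m n : nat) (f df : R -> 'M[R]_(m, n))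
    (L kap a b : R) :
  0 <= kap -> 0 <= L -> 0 <= a -> a <= b ->
  (forall s, s \in `]a, b[%R -> is_derive s 1 f (df s)) ->
  (forall s, s \in `]a, b[%R ->
    frob_norm (df s) <= kap + L * frob_norm (f s)) ->
  {within `[a, b], continuous f} ->
  frob_norm (f a) <= kap * a * expR (L * a) ->
  frob_norm (f b) <= kap * b * expR (L * b).
Proof.
move=> kap0 L0 a0 ab fd dfle fc fa.
suff h (del : R) : 0 < del ->
    frob_norm (f b) <= kap * b * expR (L * b) + expR (L * b) * del.
  apply/ler_addgt0Pr => e e0.
  have E0 := expR_gt0 (L * b).
  have := h (e / expR (L * b)); rewrite divr_gt0// => /(_ isT).
  by rewrite mulrCA divff ?mulr1// gt_eqF.
move=> del0.
pose q s := Num.sqrt (mxdot (f s) (f s) + del ^+ 2).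
have q0 s : 0 < mxdot (f s) (f s) + del ^+ 2.
  by rewrite ltr_wpDl ?mxdot_ge0// exprn_gt0.
have fq s : frob_norm (f s) <= q s.
  by rewrite frob_normE /q ler_sqrt ?(ltW (q0 s))// lerDl sqr_ge0.
have qf s : q s <= frob_norm (f s) + del.
  rewrite /q -frob_sqr -[leRHS]ger0_norm ?addr_ge0 ?frob_ge0 ?(ltW del0)//.
  rewrite -sqrtr_sqr ler_sqrt ?sqr_ge0// sqrrD -addrA lerD2l lerDr.
  by rewrite mulrn_wge0// mulr_ge0 ?frob_ge0 ?(ltW del0).
pose p s := expR (- L * s) * q s - kap * s.
pose dq s := (2 * q s)^-1 * (2 * mxdot (f s) (df s)).
pose dp s := expR (- L * s) * dq s + q s * (expR (- L * s) * - L) - kap.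
have pd s : s \in `]a, b[%R -> is_derive s 1 p (dp s).
  move=> sab.
  have qd : is_derive s 1 q (dq s).
    have e : is_derive s 1 (fun x => mxdot (f x) (f x) + del ^+ 2)
        (2 * mxdot (f s) (df s)).
      apply: (is_derive_eq (is_deriveD (is_derive_mxdot (fd s sab) (fd s sab))
        (is_derive_cst (del ^+ 2) s 1))).
      by rewrite (mxdotC (df s)); ring.
    exact: (@is_derive1_comp _ Num.sqrt
      (fun x => mxdot (f x) (f x) + del ^+ 2) s _ _ (is_derive1_sqrt (q0 s)) e).
  have ed : is_derive s 1 (fun x => expR (- L * x)) (expR (- L * s) * - L).
    apply: (is_derive1_comp (is_derive_expR _)
      (is_derive_eq (is_deriveZ (- L) (is_derive_id s 1)) _)).
    by rewrite [LHS]mulr1.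
  apply: (is_derive_eq (is_deriveB (is_deriveM ed qd)
    (is_deriveZ kap (is_derive_id s 1)))).
  by rewrite /dp [kap *: _]mulr1.
have dple s : s \in `]a, b[%R -> dp s <= 0.
  move=> sab.
  have qs0 : 0 < q s by rewrite sqrtr_gt0.
  have dqle : dq s <= kap + L * q s.
    rewrite /dq invfM mulrACA mulVf// mul1r mulrC ler_pdivrMr//.
    rewrite (le_trans (mxdot_le_frob _ _))//.
    have := dfle s sab; have := fq s; have := frob_ge0 (f s).
    move: (frob_norm (f s)) (frob_norm (df s)) => u v u0 uq vle.
    apply: (@le_trans _ _ (u * (kap + L * u))); first by rewrite ler_wpM2l.
    have : 0 <= kap * (q s - u) by rewrite mulr_ge0// subr_ge0.
    have : L * (u * u) <= L * (q s * q s) by rewrite ler_wpM2l// ler_pM.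
    lra.
  have E1 : expR (- L * s) <= 1.
    rewrite -expR0 ler_expR mulNr oppr_le0 mulr_ge0//.
    by move: sab; rewrite in_itv/= => /andP[/ltW/(le_trans a0)].
  have E0 := expR_gt0 (- L * s).
  have : expR (- L * s) * dq s <= expR (- L * s) * (kap + L * q s).
    by rewrite ler_wpM2l// ltW.
  have : expR (- L * s) * kap <= 1 * kap by rewrite ler_wpM2r.
  rewrite /dp; lra.
have idc : {within `[a, b], continuous (id : R -> R)}.
  by apply: continuous_subspaceT => x; exact: cvg_id.
have pc : {within `[a, b], continuous p}.
  move=> s; set S := nbhs (s : subspace `[a, b]).
  have qc : q x @[x --> S] --> q s.
    apply: (@cvg_comp _ _ _ (fun x => mxdot (f x) (f x) + del ^+ 2) Num.sqrt S
      (nbhs (mxdot (f s) (f s) + del ^+ 2))); last exact: sqrt_continuous.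
    apply: cvgD; last exact: cvg_cst.
    exact: (@cvg_mxdot R m n _ S _ f f _ _ (fc s) (fc s)).
  apply: cvgB; last by apply: cvgM; [exact: cvg_cst|exact: (idc s)].
  apply: cvgM => //.
  apply: (@cvg_comp _ _ _ (fun x : R => - L * x) expR S (nbhs (- L * s))).
    by apply: cvgM; [exact: cvg_cst|exact: (idc s)].
  exact: continuous_expR.
have : p b <= p a.
  have [->//|ab'] := eqVneq a b.
  have {}ab : a < b by rewrite lt_def eq_sym ab' ab.
  have [c cab] := MVT ab pd pc.
  have : dp c * (b - a) <= 0 by rewrite mulr_le0_ge0 ?dple// subr_ge0 ltW.
  lra.
rewrite /p => pab.
have Ea0 := expR_gt0 (- L * a); have Eb0 := expR_gt0 (L * b).
have Ea : expR (- L * a) * expR (L * a) = 1.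
  by rewrite -expRD -mulrDl addNr mul0r expR0.
have Eb : expR (L * b) * expR (- L * b) = 1.
  by rewrite -expRD -mulrDl subrr mul0r expR0.
have Ea1 : expR (- L * a) <= 1.
  by rewrite -expR0 ler_expR mulNr oppr_le0 mulr_ge0.
have h1 : expR (- L * a) * q a <= kap * a + del.
  apply: (@le_trans _ _ (expR (- L * a) * (kap * a * expR (L * a) + del))).
    by rewrite ler_pM2l// (le_trans (qf a))// lerD2r.
  rewrite mulrDr mulrCA Ea mulr1 lerD2l ger_pMl//.
have h2 : expR (- L * b) * q b <= kap * b + del by move: pab h1; lra.
rewrite (le_trans (fq b))// -[q b]mul1r -Eb -(mulrA (expR (L * b))).
by rewrite [kap * b * _]mulrC -mulrDr ler_pM2l.
Qed.

Lemma has_deriv_withinP (R : realType) (m n : nat) (D : set R)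
    (f : R -> 'M[R]_(m, n)) (s : R) (df : 'M[R]_(m, n)) :
  has_deriv_within D f s df ->
  forall e : R, 0 < e -> exists2 d : R, 0 < d & forall u, D u -> u != s ->
    `|u - s| < d -> `|df - (u - s)^-1 *: (f u - f s)| <= e.
Proof.
move=> /cvgrPdist_le H e /H; rewrite near_withinE near_withinE.
move=> /nbhs_ballP[d /= d0 dD]; exists d => // u Du us usd.
by apply: dD => //=; rewrite /ball/= distrC.
Qed.

Lemma is_derive_within (R : realType) (m n : nat) (a b : R)
    (f : R -> 'M[R]_(m, n)) (s : R) (df : 'M[R]_(m, n)) :
  a < s < b -> has_deriv_within `[a, b]%classic f s df -> is_derive s 1 f df.
Proof.
move=> /andP[as_ sb] /has_deriv_withinP fs.
suff fd : (fun h => h^-1 *: ((f \o shift s) (h *: (1 : R)) - f s)) @ 0^' --> df.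
  by apply: DeriveDef; [apply/cvg_ex; exists df|exact/cvg_lim].
apply/cvgrPdist_le => e e0; have [d d0 dle] := fs e e0.
near=> x.
have x0 : x != 0 by near: x; exact: nbhs_dnbhs_neq.
have xd : `|x| < Num.min d (Num.min (s - a) (b - s)).
  by near: x; apply: dnbhs0_lt; rewrite !lt_min d0 !subr_gt0 as_.
move: xd; rewrite !lt_min => /and3P[xd xa xb].
have xE : x *: 1 + s - s = x by rewrite addrK [_ *: _]mulr1.
rewrite /= -{1}xE; apply: dle; rewrite ?xE//=.
  rewrite in_itv/= [_ *: _]mulr1.
  by move: xa xb; rewrite !ltr_norml => /andP[? ?] /andP[? ?]; lra.
by rewrite -subr_eq0 xE.
Unshelve. all: by end_near. Qed.

Lemma has_deriv_within_continuous (R : realType) (m n : nat) (a b c : R)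
    (f df : R -> 'M[R]_(m, n)) :
  c <= b ->
  (forall s, a <= s <= b -> has_deriv_within `[a, b]%classic f s (df s)) ->
  {within `[a, c], continuous f}.
Proof.
move=> cb fd; apply/subspace_continuousP => s.
rewrite /= in_itv/= => /andP[as_ sc].
have /fd/has_deriv_withinP fs : a <= s <= b by rewrite as_ (le_trans sc).
have [d d0 dle] := fs 1 ltr01.
apply/cvgrPdist_le => e e0; rewrite near_withinE.
have K0 : 0 < `|df s| + 1 by rewrite ltr_wpDl.
near=> u => /=; rewrite in_itv/= => /andP[au uc].
have [->|us] := eqVneq u s; first by rewrite subrr normr0 ltW.
have usd : `|u - s| < Num.min d (e / (`|df s| + 1)).
  rewrite distrC; near: u; apply: nbhsx_ballx.
  by rewrite lt_min d0 divr_gt0.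
move: usd; rewrite lt_min => /andP[usd use].
have ub : `[a, b]%classic u by rewrite /= in_itv/= au (le_trans uc).
have us0 : u - s != 0 by rewrite subr_eq0.
have q1 : `|(u - s)^-1 *: (f u - f s)| <= `|df s| + 1.
  rewrite -[_ *: _](subKr (df s)) (le_trans (ler_normB _ _))// lerD2l.
  exact: dle.
rewrite distrC -[f u - f s]scale1r -(divff us0) -scalerA normrZ.
rewrite (le_trans (ler_wpM2l _ q1))// -ler_pdivlMr//.
exact: ltW.
Unshelve. all: by end_near. Qed.

Lemma abs_continuous_lipschitz (R : realType) (m n : nat)
    (f : R -> 'M[R]_(m, n)) (K h : R) :
  (forall x y : R, 0 <= x -> x <= y -> y <= h ->
    frob_norm (f y - f x) <= K * (y - x)) ->
  abs_continuous_on 0 h f.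
Proof.
move=> flip e e0.
have K0 : 0 < `|K| + 1 by rewrite ltr_wpDl.
exists (e / (`|K| + 1)) => [|N x y xy _]; first by rewrite divr_gt0.
rewrite ltr_pdivlMr// => /le_lt_trans; apply; rewrite mulr_suml.
apply: ler_sum => i _; have [x0 xyi yh] := xy i.
rewrite (le_trans (flip _ _ _ _ _))// mulrC ler_wpM2l ?subr_ge0//.
by have := ler_norm K; lra.
Qed.

Lemma ae_finite (R : realType) (s : seq R) (P : R -> Prop) :
  (forall x, x \notin s -> P x) -> {ae @lebesgue_measure R, forall x, P x}.
Proof.
move=> sP; exists [set` s]; split.
- by apply: countable_measurable => //; exact/finite_set_countable/finite_seq.
- exact/countable_lebesgue_measure0/finite_set_countable/finite_seq.
- move=> x /= nP; apply/negPn/negP => xs; exact/nP/sP.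
Qed.

(** * Euler polygons *)

Lemma is_derive_mx (R : realType) (m n : nat) (f : R -> 'M[R]_(m, n)) (s : R)
    (df : 'M[R]_(m, n)) :
  (forall i j, is_derive s 1 (fun x => f x i j) (df i j)) -> is_derive s 1 f df.
Proof.
move=> fij; have fs : derivable f s 1.
  by apply/derivable_mxP => i j; case: (fij i j).
apply: DeriveDef => //; rewrite derive_mx//; apply/matrixP => i j; rewrite mxE.
by case: (fij i j).
Qed.

(** One step from [Y] at time [c], with the factors, and not the matrix, moved
    along straight lines. *)
Definition euler_step (R : realType) (m n : nat) (Y : 'M[R]_(m, n))
    (M : 'M[R]_m) (N : 'M[R]_n) (c s : R) : 'M[R]_(m, n) :=
  (1%:M + (s - c) *: M) *m Y *m (1%:M + (s - c) *: N).

Lemma euler_stepE (R : realType) (m n : nat) (Y : 'M[R]_(m, n)) (M : 'M[R]_m)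
    (N : 'M[R]_n) (c s : R) :
  euler_step Y M N c s = Y + (s - c) *: (M *m Y + Y *m N)
    + (s - c) ^+ 2 *: (M *m Y *m N).
Proof.
rewrite /euler_step !(mulmxDl, mulmxDr) mul1mx !mulmx1 -!scalemxAl -!scalemxAr.
by rewrite scalerDr scalerA -expr2 !addrA.
Qed.

Lemma is_derive_euler_step (R : realType) (m n : nat) (Y : 'M[R]_(m, n))
    (M : 'M[R]_m) (N : 'M[R]_n) (c s : R) :
  is_derive s 1 (euler_step Y M N c)
    (M *m Y + Y *m N + (2 * (s - c)) *: (M *m Y *m N)).
Proof.
apply: is_derive_mx => i j.
have -> : (fun x => euler_step Y M N c x i j) = (fun x =>
    Y i j + (x - c) * (M *m Y + Y *m N) i j + (x - c) ^+ 2 * (M *m Y *m N) i j).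
  apply/funext => x; rewrite euler_stepE.
  by move: (M *m Y + Y *m N) (M *m Y *m N) => G H; rewrite !mxE.
move: (M *m Y + Y *m N) (M *m Y *m N) => G H.
have d1 : is_derive s 1 (fun x : R => x - c) 1.
  apply: (is_derive_eq (is_deriveB (is_derive_id s 1) (is_derive_cst c s 1))).
  by rewrite subr0.
apply: (is_derive_eq (is_deriveD (is_deriveD (is_derive_cst (Y i j) s 1)
  (is_deriveM d1 (is_derive_cst (G i j) s 1)))
  (is_deriveM (is_deriveM d1 d1) (is_derive_cst (H i j) s 1)))).
rewrite !mxE /cst /= !scaler0 add0r add0r add0r /GRing.scale/=; ring.
Qed.

Lemma euler_step_lipschitz (R : realType) (m n : nat) (Y : 'M[R]_(m, n))
    (M : 'M[R]_m) (N : 'M[R]_n) (C b c x y : R) :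
  0 <= C -> frob_norm M <= C -> frob_norm N <= C -> frob_norm Y <= b ->
  c <= x -> x <= y -> y <= c + 1 ->
  frob_norm (euler_step Y M N c y - euler_step Y M N c x)
    <= (y - x) * (2 * C * b + 2 * C ^+ 2 * b).
Proof.
move=> C0 MC NC Yb cx xy yc.
have MY : frob_norm (M *m Y) <= C * b by exact: frob_mulW.
have YN : frob_norm (Y *m N) <= C * b by rewrite mulrC; exact: frob_mulW.
have MYN : frob_norm (M *m Y *m N) <= C * b * C by exact: frob_mulW.
have -> : euler_step Y M N c y - euler_step Y M N c x = (y - x) *:
    (M *m Y + Y *m N + ((y - c) + (x - c)) *: (M *m Y *m N)).
  rewrite !euler_stepE; move: (M *m Y + Y *m N) (M *m Y *m N) => G H.
  by apply/matrixP => i j; rewrite !mxE; ring.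
rewrite frobZ ger0_norm ?subr_ge0// ler_wpM2l ?subr_ge0//.
have h0 : 0 <= (y - c) + (x - c) by lra.
have h2 : (y - c) + (x - c) <= 2 by lra.
rewrite (le_trans (frobD _ _))// lerD//.
  by rewrite (le_trans (frobD _ _))//; lra.
rewrite frobZ ger0_norm// expr2 -!mulrA ler_pM ?frob_ge0//.
by rewrite mulrCA mulrC.
Qed.

(** What the construction maintains on [[0, S]].  The factors are allowed to
    drift from the identity at speed [2 * C], twice the bound on the matrices
    [M] and [N] of a step.  The comparison with [A] is carried along so that
    the Gronwall estimate is only used between two corners, where the curve is
    differentiable. *)
Definition admissible (R : realType) (m n : nat)
    (F : R -> 'M[R]_(m, n) -> 'M[R]_(m, n)) (A : R -> 'M[R]_(m, n))
    (Y0 : 'M[R]_(m, n)) (L kap C K S : R) (Yt : R -> 'M[R]_(m, n)) : Prop :=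
  [/\ Yt 0 = Y0,
      forall x y : R, 0 <= x -> x <= y -> y <= S ->
        frob_norm (Yt y - Yt x) <= K * (y - x),
      exists nodes : seq R, forall s : R, 0 < s < S -> s \notin nodes ->
        exists2 D, is_derive s 1 Yt D & frob_norm (D - F s (Yt s)) <= kap,
      forall s : R, 0 <= s <= S -> exists Phi Psi,
        [/\ frob_norm (Phi - 1%:M) <= 2 * C * s,
            frob_norm (Psi - 1%:M) <= 2 * C * s & Yt s = Phi *m Y0 *m Psi] &
      forall s : R, 0 <= s <= S ->
        frob_norm (Yt s - A s) <= kap * s * expR (L * s)].

Lemma near_id_step (R : realType) (p : nat) (X M : 'M[R]_p) (C S sig : R) :
  0 <= sig -> 2 * C * S <= 2^-1 -> frob_norm M <= C ->
  frob_norm (X - 1%:M) <= 2 * C * S ->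
  frob_norm ((1%:M + sig *: M) *m X - 1%:M) <= 2 * C * (S + sig).
Proof.
move=> sig0 CS MC X1.
have Xn : near_id X^T by apply: near_id_tr; exact: le_trans CS.
rewrite mulmxDl mul1mx addrAC -scalemxAl (le_trans (frobD _ _))//.
rewrite mulrDr lerD// frobZ ger0_norm// mulrC ler_wpM2r//.
have [] := near_id_mull M^T Xn; rewrite -trmx_mul !frob_tr => h _.
by have := frob_ge0 M; lra.
Qed.

(** [eta] bounds the splitting error at the start of the step, [gap] the
    variation of [F] in time, and [(1 + L) * K * k] the two effects of the
    motion of the matrix: the change of [F] and the second-order term of the
    velocity. *)
Lemma admissible_extend (R : realType) (m n : nat)
    (F : R -> 'M[R]_(m, n) -> 'M[R]_(m, n)) (A : R -> 'M[R]_(m, n))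
    (Y0 : 'M[R]_(m, n)) (L kap C K h S k b eta gap : R)
    (Yt : R -> 'M[R]_(m, n)) :
  0 <= L -> 0 <= kap -> 0 <= C -> 2 * C * h <= 2^-1 ->
  0 <= S -> 0 < k <= 1 -> S + k <= h ->
  b = 9 / 4 * frob_norm Y0 -> K = 2 * C * b + 2 * C ^+ 2 * b ->
  eta + gap + (1 + L) * K * k <= kap ->
  (forall (s : R) X Z, 0 <= s <= h ->
    frob_norm (F s X - F s Z) <= L * frob_norm (X - Z)) ->
  (forall Y, near_equiv Y0 Y -> exists M : 'M[R]_m, exists N : 'M[R]_n,
    [/\ frob_norm M <= C, frob_norm N <= C &
        frob_norm (F S Y - (M *m Y + Y *m N)) <= eta]) ->
  (forall (s : R) Y, S <= s <= S + k -> frob_norm Y <= b ->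
    frob_norm (F s Y - F S Y) <= gap) ->
  (forall s : R, 0 < s < h -> is_derive s 1 A (F s (A s))) ->
  {within `[0, h], continuous A} ->
  admissible F A Y0 L kap C K S Yt ->
  exists Yt', admissible F A Y0 L kap C K (S + k) Yt'.
Proof.
move=> L0 kap0 C0 Ch S0 /andP[k0 k1] Skh bE KE small Flip Fsplit Ftime Ad Ac.
move=> [Yt0 Ytlip [nodes Ytd] Ytfac Ytgron].
have SS : 0 <= S <= S by rewrite S0 lexx.
have [Phi [Psi [Phi1 Psi1 YS]]] := Ytfac S SS.
have CS : 2 * C * S <= 2^-1.
  by apply: le_trans Ch; rewrite ler_wpM2l ?mulr_ge0//; lra.
have Yeq : near_equiv Y0 (Yt S).
  by exists Phi, Psi; split => //; exact: le_trans CS.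
have [Yb _] := near_equiv_frob Yeq; rewrite -bE in Yb.
have [M [N [MC NC MN]]] := Fsplit _ Yeq.
pose Z := euler_step (Yt S) M N S.
have ZS : Z S = Yt S by rewrite /Z euler_stepE subrr expr0n/= !scale0r !addr0.
have b0 : 0 <= b by apply: le_trans Yb; exact: frob_ge0.
have K0 : 0 <= K by rewrite KE addr_ge0// !mulr_ge0// sqr_ge0.
have Zlip (x y : R) : S <= x -> x <= y -> y <= S + k ->
    frob_norm (Z y - Z x) <= K * (y - x).
  move=> Sx xy yk; rewrite mulrC KE; apply: euler_step_lipschitz => //.
  by rewrite (le_trans yk)// lerD2l.
pose DZ (s : R) := M *m Yt S + Yt S *m N + (2 * (s - S)) *: (M *m Yt S *m N).
have Zd (s : R) : is_derive s 1 Z (DZ s) by exact: is_derive_euler_step.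
have DZle (s : R) : S <= s <= S + k -> frob_norm (DZ s - F s (Z s)) <= kap.
  move=> /andP[Ss sk].
  have sh : 0 <= s <= h by lra.
  have e1 : frob_norm (F s (Yt S) - F S (Yt S)) <= gap by apply: Ftime; lra.
  have e2 : frob_norm (F s (Yt S) - F s (Z s)) <= L * (K * k).
    rewrite (le_trans (Flip _ _ _ sh))// ler_wpM2l// -ZS frobB.
    rewrite (le_trans (Zlip _ _ _ _ _))// ler_wpM2l//; lra.
  have e3 : frob_norm ((2 * (s - S)) *: (M *m Yt S *m N)) <= K * k.
    rewrite frobZ ger0_norm ?mulr_ge0 ?subr_ge0//.
    have h1 : frob_norm (M *m Yt S *m N) <= C * b * C.
      by apply: frob_mulW => //; exact: frob_mulW.
    apply: (@le_trans _ _ (2 * k * (C * b * C))).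
      by apply: ler_pM; rewrite ?frob_ge0//; lra.
    have : 0 <= 2 * C * b * k by rewrite !mulr_ge0// ltW.
    by rewrite KE; lra.
  have -> : DZ s - F s (Z s) = (2 * (s - S)) *: (M *m Yt S *m N)
      - (F S (Yt S) - (M *m Yt S + Yt S *m N))
      - (F s (Yt S) - F S (Yt S)) + (F s (Yt S) - F s (Z s)).
    rewrite /DZ; move: (M *m Yt S + Yt S *m N) (M *m Yt S *m N) => G H.
    by apply/matrixP => i j; rewrite !mxE; ring.
  apply: (@le_trans _ _ (K * k + eta + gap + L * (K * k))); last by lra.
  rewrite (le_trans (frobD _ _))// lerD//.
  rewrite (le_trans (frobD _ _))// lerD ?frobN//.
  by rewrite (le_trans (frobD _ _))// lerD ?frobN.
pose Yt' (s : R) := if s <= S then Yt s else Z s.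
have Ytl (s : R) : s <= S -> Yt' s = Yt s by rewrite /Yt' => ->.
have Ytr (s : R) : S <= s -> Yt' s = Z s.
  rewrite /Yt' le_eqVlt => /predU1P[<-|]; first by rewrite lexx ZS.
  by rewrite ltNge => /negPf ->.
exists Yt'; split.
- by rewrite Ytl.
- move=> x y x0 xy yk.
  have [yS|/ltW Sy] := leP y S; first by rewrite !Ytl ?(le_trans xy)// Ytlip.
  rewrite (Ytr y)//.
  have [xS|/ltW Sx] := leP x S; last by rewrite Ytr// Zlip.
  rewrite Ytl// -(subrKA (Yt S)) (le_trans (frobD _ _))//.
  have h1 : frob_norm (Z y - Yt S) <= K * (y - S) by rewrite -ZS Zlip.
  have h2 : frob_norm (Yt S - Yt x) <= K * (S - x) by rewrite Ytlip.
  by rewrite (le_trans (lerD h1 h2))// -mulrDr subrKA.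
- exists (S :: nodes) => s /andP[s0 sk].
  rewrite in_cons negb_or => /andP[sS sn].
  have [sltS|Slts] := ltP s S.
    have [|D Dd Dle] := Ytd s _ sn; first by rewrite s0.
    exists D; last by rewrite Ytl// ltW.
    apply: near_eq_is_derive Dd; near=> x; rewrite Ytl//.
    by apply: ltW; near: x; exact: lt_nbhsl.
  have {Slts} Ss : S < s by rewrite lt_def sS.
  exists (DZ s); last by rewrite Ytr ?DZle// ?ltW//; lra.
  apply: near_eq_is_derive (Zd s); near=> x; rewrite Ytr//.
  by apply: ltW; near: x; exact: lt_nbhsr.
- move=> s /andP[s0 sk]; have [sS|/ltW Ss] := leP s S.
    by rewrite Ytl//; apply: Ytfac; rewrite s0.
  rewrite Ytr//.
  exists ((1%:M + (s - S) *: M) *m Phi), (Psi *m (1%:M + (s - S) *: N)).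
  split.
  + rewrite -[X in _ * X](subrKC S s).
    by apply: near_id_step; rewrite ?subr_ge0.
  + rewrite -[X in _ * X](subrKC S s) -frob_tr linearB /= trmx_mul trmx1.
    rewrite linearD /= linearZ /= trmx1.
    apply: near_id_step; rewrite ?subr_ge0 ?frob_tr//.
    by rewrite -trmx1 -linearB /= frob_tr.
  + by rewrite /Z /euler_step YS !mulmxA.
- move=> s /andP[s0 sk]; have [sS|/ltW Ss] := leP s S.
    by rewrite Ytl//; apply: Ytgron; rewrite s0.
  rewrite Ytr//.
  apply: (@gronwall _ _ _ (fun x => Z x - A x) (fun x => DZ x - F x (A x))
    L kap S) => //.
  + move=> x; rewrite in_itv/= => /andP[Sx xs].
    by apply: is_deriveB; apply: Ad; lra.
  + move=> x; rewrite in_itv/= => /andP[Sx xs].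
    rewrite -(subrKA (F x (Z x))) (le_trans (frobD _ _))// lerD//.
      by apply: DZle; lra.
    by apply: Flip; lra.
  + move=> x; apply: cvgB.
      apply: (continuous_subspaceT (f := Z)) => y.
      by apply/differentiable_continuous/derivable1_diffP; case: (Zd y).
    apply: (continuous_subspaceW (B := `[0, h]%classic)) => //.
    by apply: subset_itv; rewrite bnd_simp//; lra.
  + by rewrite ZS; apply: Ytgron.
Unshelve. all: by end_near. Qed.

(** The step length is chosen once for all: [near_equiv_frob] keeps the norm
    between a quarter and nine quarters of that of [Y0], so the margin given by
    [tangent_split] and the modulus of continuity of [F] are the same at every
    step. *)
Lemma approx_curve (R : realType) (m n r : nat)
    (F : R -> 'M[R]_(m, n) -> 'M[R]_(m, n)) (A : R -> 'M[R]_(m, n))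
    (Y0 : 'M[R]_(m, n)) (L eps C K h b : R) :
  (0 < r)%N -> (r < m)%N -> (r < n)%N -> 0 <= L -> 0 < eps ->
  C = (m * n)%:R * (2 * L + 1) -> 0 < h -> 2 * C * h <= 2^-1 ->
  b = 9 / 4 * frob_norm Y0 -> K = 2 * C * b + 2 * C ^+ 2 * b ->
  (forall c e : R, 0 < e -> exists2 d : R, 0 < d & forall s s' X,
    0 <= s <= h -> 0 <= s' <= h -> `|s' - s| < d -> frob_norm X <= c ->
    frob_norm (F s' X - F s X) <= e) ->
  (forall (s : R) X Z, 0 <= s <= h ->
    frob_norm (F s X - F s Z) <= L * frob_norm (X - Z)) ->
  (forall (s : R) (U : 'M[R]_(m, r)) (S : 'M[R]_r) (V : 'M[R]_(n, r)),
      0 <= s <= h ->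
      U^T *m U = 1%:M -> V^T *m V = 1%:M -> S \in unitmx ->
      frob_norm ((1%:M - U *m U^T) *m F s (U *m S *m V^T)
                 *m (1%:M - V *m V^T)) <= eps) ->
  \rank Y0 = r -> A 0 = Y0 ->
  (forall s : R, 0 < s < h -> is_derive s 1 A (F s (A s))) ->
  {within `[0, h], continuous A} ->
  exists Yt, admissible F A Y0 L (Num.sqrt (m * n)%:R * eps) C K h Yt.
Proof.
move=> r0 rm rn L0 eps0 CE h0 Ch bE KE Ftime Flip Fnorm Y0r A0 Ad Ac.
have Y0n : 0 < frob_norm Y0.
  rewrite lt_def frob_ge0 andbT; apply/eqP => /frob_eq0 Y00.
  by move: r0; rewrite -Y0r Y00 mxrank0.
have mu0 : 0 < frob_norm Y0 / 4 by rewrite divr_gt0.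
have [eta /andP[eta0 etak] Fsplit] := tangent_split r0 rm rn L0 eps0 mu0.
set kap := Num.sqrt _ * _ in etak *.
have kap0 : 0 <= kap by exact: le_trans (ltW etak).
have C0 : 0 <= C by rewrite CE mulr_ge0// addr_ge0// mulr_ge0.
have b0 : 0 <= b by rewrite bE mulr_ge0// ltW.
have K0 : 0 <= K by rewrite KE addr_ge0// !mulr_ge0// sqr_ge0.
pose gap := (kap - eta) / 2.
have gap0 : 0 < gap by rewrite divr_gt0// subr_gt0.
have [d d0 dF] := Ftime b gap gap0.
pose w := (1 + L) * K + 1.
have w0 : 0 < w by rewrite ltr_wpDl// mulr_ge0// addr_ge0.
pose del := Num.min d (Num.min 1 (gap / w)).
have del0 : 0 < del by rewrite !lt_min d0 ltr01 divr_gt0.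
pose N := (Num.truncn (h / del)).+1.
pose k := h / N%:R.
have k0 : 0 < k by rewrite divr_gt0// ltr0n.
have kdel : k < del.
  by rewrite /k ltr_pdivrMr ?ltr0n// mulrC -ltr_pdivrMr// truncnS_gt.
have [kd k1 kw] : [/\ k < d, k <= 1 & k * w <= gap].
  move: kdel; rewrite !lt_min => /and3P[? /ltW ? /ltW].
  by rewrite ler_pdivlMr//; split.
have Nk : N%:R * k = h by rewrite /k mulrCA divff ?mulr1// pnatr_eq0.
suff : forall i, (i <= N)%N ->
    exists Yt, admissible F A Y0 L kap C K (i%:R * k) Yt.
  by move=> /(_ N (leqnn N)); rewrite Nk.
elim=> [_|i IH iN].
  have z0 (s : R) : 0 <= s <= 0 -> s = 0 by rewrite andbC => /le_anti.
  exists (cst Y0); rewrite mul0r; split=> //.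
  - move=> x y x0 xy y0; rewrite subrr frob0 mulr_ge0// subr_ge0//.
  - by exists [::] => s /andP[s0 /(lt_trans s0)]; rewrite ltxx.
  - move=> s /z0 ->; exists 1%:M, 1%:M.
    by rewrite !subrr !frob0 mulr0 mul1mx mulmx1.
  - by move=> s /z0 ->; rewrite A0 /cst subrr frob0 mulr0 mul0r.
have [Yt Ytadm] := IH (ltnW iN).
have Skh : i%:R * k + k <= h.
  by rewrite -[X in _ + X]mul1r -mulrDl natr1 -Nk ler_pM2r// ler_nat.
have S0 : 0 <= i%:R * k by rewrite mulr_ge0// ltW.
rewrite -natr1 mulrDl mul1r.
apply: (@admissible_extend _ _ _ F A Y0 L kap C K h _ k b eta gap Yt) => //.
- by rewrite k0.
- have : gap + gap = kap - eta by rewrite /gap; field.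
  by move: kw; rewrite /w; nra.
- move=> Y Yeq; rewrite CE; apply: Fsplit.
  + by move=> X Z; apply: Flip; lra.
  + by move=> U S V; apply: Fnorm; lra.
  + by rewrite (near_equiv_rank Yeq).
  + by have [_] := near_equiv_frob Yeq; lra.
- move=> s Y sS Yb; apply: dF => //; [lra|lra|].
  by rewrite ger0_norm; lra.
Qed.

(** * Existence of the curve *)

Lemma lip_const_ge0 (R : realType) (m n : nat) (L : R)
    (F : 'M[R]_(m, n) -> 'M[R]_(m, n)) :
  (0 < m)%N -> (0 < n)%N ->
  (forall X Z, frob_norm (F X - F Z) <= L * frob_norm (X - Z)) -> 0 <= L.
Proof.
case: m F => // m; case: n => // n F _ _ Flip.
pose X : 'M[R]_(m.+1, n.+1) := const_mx 1.
have X0 : 0 < frob_norm (X - 0).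
  by apply: lt_le_trans (le_entry_frob _ ord0 ord0); rewrite !mxE subr0 normr1.
by have := le_trans (frob_ge0 _) (Flip X 0); rewrite pmulr_lge0.
Qed.

Theorem lemma4p2 (R : realType) (m n r : nat) (LF : R) :
  (0 < r)%N -> (r < minn m n)%N ->
  exists2 hs : R, 0 < hs &
  forall (T B eps : R) (F : R -> 'M[R]_(m, n) -> 'M[R]_(m, n)),
    0 < T ->
    0 <= eps ->
    {within `[0, T]%classic `*` [set: 'M[R]_(m, n)],
      continuous (fun p : R * 'M[R]_(m, n) => F p.1 p.2)} ->
    (forall (t : R) (X : 'M[R]_(m, n)), 0 <= t <= T ->
      frob_norm (F t X) <= B) ->
    (forall (t : R) (X Z : 'M[R]_(m, n)), 0 <= t <= T ->
      frob_norm (F t X - F t Z) <= LF * frob_norm (X - Z)) ->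
    (forall (t : R) (U : 'M[R]_(m, r)) (S : 'M[R]_r) (V : 'M[R]_(n, r)),
      0 <= t <= T ->
      U^T *m U = 1%:M -> V^T *m V = 1%:M -> S \in unitmx ->
      frob_norm ((1%:M - U *m U^T) *m F t (U *m S *m V^T)
                 *m (1%:M - V *m V^T)) <= eps) ->
  forall (Y0 : 'M[R]_(m, n)) (V0 : 'M[R]_(n, r)) (h t0 : R)
      (A : R -> 'M[R]_(m, n)),
    \rank Y0 = r ->
    V0^T *m V0 = 1%:M ->
    Y0 = Y0 *m V0 *m V0^T ->
    0 < h <= hs ->
    0 <= t0 <= T - h ->
    A 0 = Y0 ->
    (forall s : R, 0 <= s <= T - t0 ->
      has_deriv_within `[0, T - t0]%classic A s (F (t0 + s) (A s))) ->
  exists Yt : R -> 'M[R]_(m, n),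
    [/\ abs_continuous_on 0 h Yt,
        Yt 0 = Y0,
        (forall s : R, 0 <= s <= h -> \rank (Yt s) = r),
        {ae @lebesgue_measure R, forall s : R, 0 <= s <= h ->
          derivable Yt s 1 /\
          frob_norm (derive1 Yt s - F (t0 + s) (Yt s))
            <= Num.sqrt (m * n)%:R * eps} &
        (forall s : R, 0 <= s <= h ->
          frob_norm (Yt s - A s)
            <= Num.sqrt (m * n)%:R * eps * s * expR (LF * s) /\
          exists2 Q : 'M[R]_(r, n),
            Yt s = (Yt s *m V0) *m Q & op_norm Q <= 3)].
Proof.
move=> r0 rmn; have [rm rn] : (r < m)%N /\ (r < n)%N.
  by apply/andP; rewrite -ltn_min.
(* [LF] is only known to be nonnegative once a field [F] is given. *)
pose C := (m * n)%:R * (2 * `|LF| + 1) : R.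
have C0 : 0 < C.
  rewrite mulr_gt0 ?ltr_wpDl ?mulr_ge0// ltr0n muln_gt0.
  by rewrite (leq_trans _ rm)// (leq_trans _ rn).
have C4 : 0 < 4 * C by rewrite mulr_gt0.
(* This keeps the drift [2 * C * h] of the factors within 1/2. *)
exists (4 * C)^-1; first by rewrite invr_gt0.
move=> T B eps F T0 eps0 Fc FB Flip Fnorm Y0 V0 h t0 A Y0r VV YV.
move=> /andP[h0 hle] /andP[t00 t0h] A0 Ad.
have Ch : 2 * C * h <= 2^-1.
  have : h * (4 * C) <= 1 by rewrite -ler_pdivlMr// mul1r.
  lra.
have time (s : R) : 0 <= s <= h -> 0 <= t0 + s <= T by lra.
pose G s X := F (t0 + s) X.
have L0 : 0 <= LF.
  by apply: (@lip_const_ge0 _ m n LF (F 0)) => [||X Z];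
    [exact: leq_ltn_trans rm|exact: leq_ltn_trans rn|apply: Flip; lra].
have CE : C = (m * n)%:R * (2 * LF + 1) by rewrite /C ger0_norm.
have Gtime c e : 0 < e -> exists2 d : R, 0 < d & forall s s' X,
    0 <= s <= h -> 0 <= s' <= h -> `|s' - s| < d -> frob_norm X <= c ->
    frob_norm (G s' X - G s X) <= e.
  move=> e0; have [d d0 dF] := time_equicontinuity c Fc e0.
  exists d => // s s' X sh s'h ss' Xc; apply: dF => //; try exact: time.
  by rewrite opprD addrACA subrr add0r.
have Glip (s : R) X Z : 0 <= s <= h ->
    frob_norm (G s X - G s Z) <= LF * frob_norm (X - Z).
  by move=> /time; exact: Flip.
have AdG (s : R) : 0 < s < h -> is_derive s 1 A (G s (A s)).
  move=> sh; apply: (@is_derive_within _ _ _ 0 (T - t0)); first lra.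
  by apply: Ad; lra.
have Ac : {within `[0, h], continuous A}.
  apply: (@has_deriv_within_continuous _ _ _ 0 (T - t0) h A
    (fun s => F (t0 + s) (A s))) => //; lra.
pose b := 9 / 4 * frob_norm Y0; pose K := 2 * C * b + 2 * C ^+ 2 * b.
have curve e : 0 < e -> eps <= e ->
    exists Yt, admissible G A Y0 LF (Num.sqrt (m * n)%:R * e) C K h Yt.
  move=> e0 epse; apply: (@approx_curve _ m n r G A Y0 LF e C K h b) => //.
  move=> s U S V /time sT UU VV' Su; apply: le_trans epse.
  exact: Fnorm.
have fac Yt kap : admissible G A Y0 LF kap C K h Yt ->
    forall s : R, 0 <= s <= h -> near_equiv Y0 (Yt s).
  move=> [_ _ _ Ytfac _] s sh; have [Phi [Psi [Phi1 Psi1 ->]]] := Ytfac s sh.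
  have Cs : 2 * C * s <= 2^-1.
    have := ler_wpM2l (ltW C0) (andP sh).2; lra.
  by exists Phi, Psi; split => //; exact: le_trans Cs.
(* Both cases [eps > 0] and [eps = 0] supply a curve with these five
   properties. *)
set kap := Num.sqrt (m * n)%:R * eps.
suff [Yt [Yt0 Ytlip [nodes Ytd] Yteq Ytgron]] : exists Yt : R -> 'M[R]_(m, n),
    [/\ Yt 0 = Y0,
        forall x y : R, 0 <= x -> x <= y -> y <= h ->
          frob_norm (Yt y - Yt x) <= K * (y - x),
        exists nodes : seq R, forall s : R, 0 < s < h -> s \notin nodes ->
          exists2 D, is_derive s 1 Yt D & frob_norm (D - G s (Yt s)) <= kap,
        forall s : R, 0 <= s <= h -> near_equiv Y0 (Yt s) &
        forall s : R, 0 <= s <= h ->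
          frob_norm (Yt s - A s) <= kap * s * expR (LF * s)].
  exists Yt; split => //.
  - exact: abs_continuous_lipschitz Ytlip.
  - by move=> s /Yteq/near_equiv_rank ->.
  - apply: (@ae_finite _ [:: 0, h & nodes]) => s.
    rewrite !in_cons !negb_or => /and3P[s0 sh sn] /andP[s0' sh'].
    have [|D Dd Dle] := Ytd s _ sn; first by rewrite !lt_def s0 s0' eq_sym sh.
    by split; [case: Dd|rewrite derive1E derive_val].
  - move=> s sh; split; first exact: Ytgron.
    exact: near_equiv_graph (Yteq s sh).
move: eps0; rewrite le_eqVlt => /predU1P[eps0|eps0]; last first.
  have [Yt Ytadm] := curve eps eps0 (lexx _).
  exists Yt; have Yteq := fac _ _ Ytadm.
  by case: Ytadm => *; split.
have kap0 : kap = 0 by rewrite /kap -eps0 mulr0.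
have close e : 0 < e -> exists Yt e', admissible G A Y0 LF e' C K h Yt /\
    forall s : R, 0 <= s <= h -> frob_norm (Yt s - A s) <= e.
  move=> e0; pose w := Num.sqrt (m * n)%:R * h * expR (LF * h) + 1.
  have w0 : 0 < w.
    by rewrite ltr_wpDl// !mulr_ge0 ?sqrtr_ge0 ?expR_ge0// ltW.
  have [e' e'0 e'w] : exists2 e', 0 < e' & e' * w = e.
    by exists (e / w); [rewrite divr_gt0|rewrite divfK ?gt_eqF].
  have [|Yt Ytadm] := curve e' e'0; first by rewrite -eps0 ltW.
  exists Yt, (Num.sqrt (m * n)%:R * e'); split => // s sh.
  have [_ _ _ _ /(_ s sh) Ytgron] := Ytadm.
  apply: (le_trans Ytgron); have /andP[s0 sleh] := sh.
  have se0 : 0 <= Num.sqrt (m * n)%:R * e' by rewrite mulr_ge0 ?sqrtr_ge0 ?ltW.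
  apply: (@le_trans _ _ (Num.sqrt (m * n)%:R * e' * h * expR (LF * h))).
    by rewrite ler_pM ?expR_ge0 ?(mulr_ge0 se0)// ?ler_expR ler_wpM2l.
  rewrite -e'w /w; lra.
(* With a zero defect the approximating curves converge to [A]. *)
exists A; split => //.
- move=> x y x0 xy yh; apply/ler_addgt0Pr => e e0.
  have [|Yt [e' [Ytadm YtA]]] := close (e / 2); first by rewrite divr_gt0.
  have [_ /(_ x y x0 xy yh) Ytlip _ _ _] := Ytadm.
  have := YtA x; rewrite x0 (le_trans xy yh) => /(_ isT) YtAx.
  have := YtA y; rewrite (le_trans x0 xy) yh => /(_ isT) YtAy.
  have -> : A y - A x = (Yt y - Yt x) + (Yt x - A x) - (Yt y - A y).
    by apply/matrixP => i j; rewrite !mxE; ring.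
  rewrite (splitr e) [leRHS]addrA (le_trans (frobD _ _))// frobN lerD//.
  by rewrite (le_trans (frobD _ _))// lerD.
- exists [::] => s sh _; exists (G s (A s)); first exact: AdG.
  by rewrite subrr frob0 kap0.
- move=> s sh; apply: near_equiv_closed => e e0.
  have [|Yt [e' [Ytadm YtA]]] := close (e / 2); first by rewrite divr_gt0.
  exists (Yt s); first exact: (fac _ _ Ytadm).
  by rewrite (le_lt_trans (YtA s sh))// gtr_pMr// invf_lt1// ltr1n.
- by move=> s _; rewrite subrr frob0 kap0 !mul0r.
Qed.
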